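(* The Sarti dodecic can be defined over $\mathbb{Q}$. That is, there is a system of linear coordinates of the $4$-dimensional space $V$ (equivalently, a $\mathbb{Q}$-form $V_{\mathbb{Q}}$ of $V$) in which the Sarti dodecic in $\mathbb{P}(V)\simeq\mathbb{P}^3(\mathbb{C})$ is the zero locus of a homogeneous polynomial of degree $12$ with rational coefficients.
   Context: Let $W=\mathrm{W}(H_4)=G_{30}$ be the Coxeter group of type $H_4$, acting on $V\simeq\mathbb{C}^4$ by (the complexification of) its reflection representation; its degrees are $2,12,20,30$. The Sarti dodecic is the irreducible surface $\mathcal{Z}(f)=\{f=0\}\subset\mathbb{P}(V)$ of degree $12$ with exactly $600$ singular points, all nodes (ordinary double points, type $A_1$), where $f$ is a homogeneous $W$-invariant polynomial of degree $12$ on $V$; by a result of Sarti such an $f$ is unique up to a scalar. *)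

(* Defs.v *)
From mathcomp Require Import all_boot all_order all_algebra.
From mathcomp Require Import complex reals.
(* trigo is not imported: the notations of the analysis library clash with
   those of mpoly. *)
From mathcomp Require trigo.
From mathcomp Require Import mpoly.

Set Implicit Arguments.
Unset Strict Implicit.
Unset Printing Implicit Defensive.

Import GRing.Theory.
Local Open Scope ring_scope.

(* A point of P(V) is a line of V. *)
Definition proj_space (K : fieldType) (V : vectType K) : Type :=
  {L : {vspace V} | \dim L == 1%N}.

Section Hypersurfaces.

Variable K : fieldType.

Definition evalv (n : nat) (f : {mpoly K[n]}) (v : 'cV[K]_n) : K :=
  f.@[fun i => v i 0].

Definition irreducible_mpoly (n : nat) (f : {mpoly K[n]}) : Prop :=
  [/\ f != 0, f \isn't a GRing.unit
    & forall g h : {mpoly K[n]}, f = g * h ->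
        g \is a GRing.unit \/ h \is a GRing.unit].

Definition on_locus (n : nat) (f : {mpoly K[n]})
    (p : proj_space 'cV[K]_n) : Prop :=
  forall v, v \in val p -> evalv f v = 0.

(* For the hypersurface with equation f, assumed homogeneous and reduced. *)
Definition singular_point (n : nat) (f : {mpoly K[n]})
    (p : proj_space 'cV[K]_n) : Prop :=
  on_locus f p /\
  forall (i : 'I_n) v, v \in val p -> evalv (mderiv i f) v = 0.

(* Equation of Z(f) in the affine chart x_i = 1, whose coordinates are the
   x_(lift i k) for k < n. *)
Definition dehomog (n : nat) (i : 'I_n.+1) (f : {mpoly K[n.+1]}) :
    {mpoly K[n]} :=
  f \mPo [tuple if unlift i j is Some k then 'X_k else 1 | j < n.+1].

(* The affine hypersurface g = 0 has an A_1 singularity at a. *)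
Definition ordinary_double_point (n : nat) (g : {mpoly K[n]})
    (a : 'I_n -> K) : Prop :=
  [/\ g.@[a] = 0,
      forall i, (mderiv i g).@[a] = 0
    & \matrix_(i < n, j < n) (mderiv i (mderiv j g)).@[a] \in unitmx].

Definition is_node (n : nat) (f : {mpoly K[n.+1]})
    (p : proj_space 'cV[K]_n.+1) : Prop :=
  forall (i : 'I_n.+1) v, v \in val p -> v i 0 = 1 ->
    ordinary_double_point (dehomog i f) (fun k => v (lift i k) 0).

End Hypersurfaces.

Section CoxeterH4.

Variable R : realType.

Definition coxH4 (i j : 'I_4) : nat :=
  nth 0%N (nth [::] [:: [:: 1; 5; 2; 2];
                        [:: 5; 1; 3; 2];
                        [:: 2; 3; 1; 3];
                        [:: 2; 2; 3; 1]]%N i) j.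

(* Reflection representation in the basis of simple roots e_i, with invariant
   form B(e_i, e_j) = - cos (pi / m_ij). *)
Definition formH4 : 'M[R[i]]_4 :=
  \matrix_(i < 4, j < 4)
    (- trigo.cos (trigo.pi / (coxH4 i j)%:R : R))%:C%C.

(* v |-> v - 2 B(e_i, v) e_i on column vectors. *)
Definition reflH4 (i : 'I_4) : 'M[R[i]]_4 :=
  1%:M - 2%:R *: (delta_mx i 0 *m row i formH4).

(* Words in the generators suffice, as these are involutions. *)
Definition WH4 (w : 'M[R[i]]_4) : Prop :=
  exists s : seq 'I_4, w = \prod_(i <- s) reflH4 i.

Definition WH4_invariant (f : {mpoly R[i][4]}) : Prop :=
  forall w, WH4 w -> forall v : 'cV[R[i]]_4, evalv f (w *m v) = evalv f v.

(* f is an equation of the Sarti dodecic; such an f is unique up to a nonzero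
   scalar (Sarti). *)
Definition sarti_equation (f : {mpoly R[i][4]}) : Prop :=
  [/\ f \is 12.-homog, WH4_invariant f, irreducible_mpoly f,
      exists s : seq (proj_space 'cV[R[i]]_4),
        [/\ uniq s, size s = 600%N & forall p, p \in s <-> singular_point f p]
    & forall p, singular_point f p -> is_node f p].

End CoxeterH4.

(* Main.v *)
(** In orthonormal coordinates, [W(H_4)] contains the sign changes and the even
permutations of the coordinates, so an invariant of degree 12 is a polynomial of
degree 6 in the squares that is invariant under the alternating group: a
combination of ten explicit forms. Invariance under one more reflection leaves a
pencil [al * F + be * q ^ 6], where [q] is the invariant quadratic form. The
coefficients of [F] lie in Q(sqrt 5), and [F] and [q] become rational after the
change of coordinates [z + sqrt 5 * t], [z - sqrt 5 * t].

It remains to see that [be / al] is rational ([al] is not zero, since [f] is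
irreducible). A subgroup of order 9, a product of two groups of order 3, acts on
the 600 singular points; as 9 does not divide 600, a singular point is fixed by
a nontrivial element, hence lies on one of six lines spanned by two common
eigenvectors. On four of these lines [q] vanishes and [F] has simple roots only;
on the two others the pencil restricts to binary forms of degree 4 in cubes,
which have a multiple root only for three rational values of [be / al]. *)

Require Import Defs.
From mathcomp Require Import all_boot all_order all_algebra.
From mathcomp Require Import complex reals.
From mathcomp Require trigo.
From mathcomp Require Import mpoly.
From mathcomp Require Import ring zify.
Set Implicit Arguments.
Unset Strict Implicit.
Unset Printing Implicit Defensive.
Import GRing.Theory Num.Theory.
Local Open Scope ring_scope.

(** * Reflections of H_4 in orthonormal coordinates and the permutations and sign changes they
    generate *)

Section Reflections.

Variable K : numFieldType.

(** For a unit vector [(a, b, c, d)] the substitution is the reflection with this root. Working with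
    functions of four scalars leaves only identities for [ring] and [field]. *)
Definition refl_invariant (p : K -> K -> K -> K -> K) (a b c d : K) : Prop :=
  forall x y z t, let r := 2 * (a * x + b * y + c * z + d * t) in
    p (x - r * a) (y - r * b) (z - r * c) (t - r * d) = p x y z t.

(** Conjugating the reflection in a root by another reflection gives the reflection in the mirror
    image of that root. *)
Lemma refl_invariant_refl p a b c d a' b' c' d' :
  a * a + b * b + c * c + d * d = 1 ->
  refl_invariant p a b c d -> refl_invariant p a' b' c' d' ->
  let r := 2 * (a * a' + b * b' + c * c' + d * d') in
  refl_invariant p (a' - r * a) (b' - r * b) (c' - r * c) (d' - r * d).
Proof.
move=> n1 H H' r x y z t r'.
have n2 : d * d = 1 - a * a - b * b - c * c by rewrite -n1; ring.
rewrite -[RHS]H -[RHS]H' -[LHS]H.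
by congr p; rewrite /r' /r; ring: n2.
Qed.

Lemma refl_invariant_eq q a b c d a' b' c' d' :
  refl_invariant q a b c d -> a = a' -> b = b' -> c = c' -> d = d' ->
  refl_invariant q a' b' c' d'.
Proof. by move=> H <- <- <- <-. Qed.

Variable s5 : K.
Hypothesis s5E : s5 * s5 = 5.
Local Notation f := ((1 + s5) / 2).
Local Notation g := ((s5 - 1) / 2).
(* The simple roots of [H_4] as unit vectors; [f] is the golden ratio and [g]
   is its inverse. *)
Variable p : K -> K -> K -> K -> K.
Hypothesis p0 : refl_invariant p 0 0 0 (-1).
Hypothesis p1 : refl_invariant p 0 (g / 2) (- 1 / 2) (f / 2).
Hypothesis p2 : refl_invariant p (- 1 / 2) (- g / 2) (f / 2) 0.
Hypothesis p3 : refl_invariant p (f / 2) (- 1 / 2) (- g / 2) 0.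

Let inv_b : refl_invariant p 0 (1 / 2) (- f / 2) (g / 2).
Proof.
apply: (refl_invariant_eq (refl_invariant_refl _ p1 p0)); by field: s5E.
Qed.

Let inv_gam : refl_invariant p (- 1 / 2) (1 / 2) (- 1 / 2) (1 / 2).
Proof.
apply: (refl_invariant_eq (refl_invariant_refl _ inv_b p2)); by field: s5E.
Qed.

Let inv_del : refl_invariant p (g / 2) (- f / 2) (1 / 2) 0.
Proof.
apply: (refl_invariant_eq (refl_invariant_refl _ p2 p3)); by field: s5E.
Qed.

Let inv_eps : refl_invariant p 0 (- f / 2) (g / 2) (1 / 2).
Proof.
by apply: (refl_invariant_eq (refl_invariant_refl _ inv_del inv_gam));
  field: s5E.
Qed.

(** The roots of [inv_del] and [p2] are orthogonal to (1, 1, 1, 0) and have inner product 1/2, so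
    the product of their reflections is a rotation of order 3 about that vector, which permutes the
    axes. *)
Lemma cycle_xyz_invariant x y z t : p x y z t = p y z x t.
Proof.
rewrite -inv_del -p2; congr p; by field: s5E.
Qed.

Lemma cycle_yzt_invariant x y z t : p x y z t = p x z t y.
Proof.
rewrite -inv_eps -inv_b; congr p; by field: s5E.
Qed.

Lemma signt_invariant x y z t : p x y z (- t) = p x y z t.
Proof. by rewrite -p0; congr p; ring. Qed.

Lemma signy_invariant x y z t : p x (- y) z t = p x y z t.
Proof.
by rewrite cycle_yzt_invariant signt_invariant -cycle_yzt_invariant.
Qed.

Lemma signz_invariant x y z t : p x y (- z) t = p x y z t.
Proof.
by rewrite cycle_yzt_invariant signy_invariant -cycle_yzt_invariant.
Qed.

Lemma signx_invariant x y z t : p (- x) y z t = p x y z t.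
Proof.
by rewrite cycle_xyz_invariant signz_invariant -cycle_xyz_invariant.
Qed.

(** This isometry is a reflection combined with sign changes. It has order 3 and commutes with the
    cyclic permutation of [y], [z], [t]; together they generate the group of order 9 that acts on
    the singular points. *)
Lemma rot3_invariant x y z t : let h := (x + y + z + t) / 2 in
  p (h - x) (y - h) (z - h) (t - h) = p x y z t.
Proof.
move=> h; rewrite -(signx_invariant x) -signz_invariant -inv_gam.
by rewrite -[RHS]signz_invariant; congr p; rewrite /h; field.
Qed.

End Reflections.

(** * Sextic forms invariant under the alternating group on four variables *)

Section AlternatingForms.

Variable K : numFieldType.
Implicit Types (q : K -> K -> K -> K -> K) (x y z t : K).

Definition vandermonde4 x y z t : K :=
  (x - y) * (x - z) * (x - t) * (y - z) * (y - t) * (z - t).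

(** The first nine terms are the monomials of weight 6 in the elementary symmetric polynomials; the
    Vandermonde determinant, also of degree 6, accounts for the alternating part. *)
Definition a4_sextic (k : seq K) x y z t : K :=
  let e1 := x + y + z + t in
  let e2 := x * y + x * z + x * t + y * z + y * t + z * t in
  let e3 := x * y * z + x * y * t + x * z * t + y * z * t in
  let e4 := x * y * z * t in
  k`_0 * e1 ^+ 6 + k`_1 * (e1 ^+ 4 * e2) + k`_2 * (e1 ^+ 3 * e3)
  + k`_3 * (e1 ^+ 2 * e2 ^+ 2) + k`_4 * (e1 ^+ 2 * e4)
  + k`_5 * (e1 * e2 * e3) + k`_6 * e2 ^+ 3 + k`_7 * e3 ^+ 2
  + k`_8 * (e2 * e4) + k`_9 * vandermonde4 x y z t.

Definition a4_span q : Prop :=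
  exists k : seq K, forall x y z t, q x y z t = a4_sextic k x y z t.

Lemma a4_span0 : a4_span (fun _ _ _ _ => 0).
Proof. by exists [::] => x y z t; rewrite /a4_sextic /=; ring. Qed.

Lemma a4_spanD q r : a4_span q -> a4_span r ->
  a4_span (fun x y z t => q x y z t + r x y z t).
Proof.
move=> [k Hk] [l Hl]; exists (mkseq (fun i => k`_i + l`_i) 10) => x y z t.
by rewrite Hk Hl /a4_sextic /=; ring.
Qed.

Lemma a4_spanZ c q : a4_span q -> a4_span (fun x y z t => c * q x y z t).
Proof.
move=> [k Hk]; exists (mkseq (fun i => c * k`_i) 10) => x y z t.
by rewrite Hk /a4_sextic /=; ring.
Qed.

Lemma a4_span_sum (I : Type) (s : seq I) (P : pred I)
    (F : I -> K -> K -> K -> K -> K) :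
  (forall i, P i -> a4_span (F i)) ->
  a4_span (fun x y z t => \sum_(i <- s | P i) F i x y z t).
Proof.
move=> HF; elim: s => [|i s [k Hk]].
  by have [k Hk] := a4_span0; exists k => x y z t; rewrite big_nil -Hk.
have [Pi|nPi] := boolP (P i); last first.
  by exists k => x y z t; rewrite big_cons (negPf nPi) Hk.
have [l Hl] := a4_spanD (HF i Pi) (ex_intro _ k Hk).
by exists l => x y z t; rewrite big_cons Pi Hl.
Qed.

Definition a4_sum q x y z t : K :=
  q x y z t + q x z t y + q x t y z + (q y x t z + q y t z x + q y z x t)
  + (q z t x y + q z x y t + q z y t x) + (q t z y x + q t y x z + q t x z y).

Definition monomial4 a b c d x y z t : K :=
  x ^+ a * y ^+ b * z ^+ c * t ^+ d.

Definition span_orbit a b c d : Prop := a4_span (a4_sum (monomial4 a b c d)).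

(** A sum over the whole group does not change when the exponents undergo an even permutation. *)
Lemma span_orbit_yzt a b c d : span_orbit a b c d -> span_orbit a c d b.
Proof.
move=> [k Hk]; exists k => x y z t; rewrite -Hk /a4_sum /monomial4; ring.
Qed.

Lemma span_orbit_xyz a b c d : span_orbit a b c d -> span_orbit b c a d.
Proof.
move=> [k Hk]; exists k => x y z t; rewrite -Hk /a4_sum /monomial4; ring.
Qed.

Let orbit6000 : span_orbit 6 0 0 0.
Proof.
exists [:: 3; -18; 18; 27; -18; -36; -6; 9; 18; 0] => x y z t.
by rewrite /a4_sextic /a4_sum /monomial4 /vandermonde4 /=; field.
Qed.

Let orbit5100 : span_orbit 5 1 0 0.
Proof.
exists [:: 0; 1; -1; -4; 1; 7; 2; -3; -6; 0] => x y z t.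
by rewrite /a4_sextic /a4_sum /monomial4 /vandermonde4 /=; field.
Qed.

Let orbit4200 : span_orbit 4 2 0 0.
Proof.
exists [:: 0; 0; -2; 1; 2; 4; -2; -3; 2; 0] => x y z t.
by rewrite /a4_sextic /a4_sum /monomial4 /vandermonde4 /=; field.
Qed.

Let orbit4110 : span_orbit 4 1 1 0.
Proof.
exists [:: 0; 0; 1; 0; -1; -3; 0; 3; 2; 0] => x y z t.
by rewrite /a4_sextic /a4_sum /monomial4 /vandermonde4 /=; field.
Qed.

Let orbit3300 : span_orbit 3 3 0 0.
Proof.
exists [:: 0; 0; 0; 0; 6; -6; 2; 6; -6; 0] => x y z t.
by rewrite /a4_sextic /a4_sum /monomial4 /vandermonde4 /=; field.
Qed.

(** Only the exponents 3, 2, 1, 0 are pairwise distinct, so only here does the orbit under all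
    permutations split into two orbits under the even ones. The two halves differ by the Vandermonde
    determinant, whence the last coefficients 1/2 and -1/2. *)
Let orbit3210 : span_orbit 3 2 1 0.
Proof.
exists [:: 0; 0; 0; 0; -3 / 2; 1 / 2; 0; -3 / 2; 2; 1 / 2] => x y z t.
by rewrite /a4_sextic /a4_sum /monomial4 /vandermonde4 /=; field.
Qed.

Let orbit2310 : span_orbit 2 3 1 0.
Proof.
exists [:: 0; 0; 0; 0; -3 / 2; 1 / 2; 0; -3 / 2; 2; -1 / 2] => x y z t.
by rewrite /a4_sextic /a4_sum /monomial4 /vandermonde4 /=; field.
Qed.

Let orbit3111 : span_orbit 3 1 1 1.
Proof.
exists [:: 0; 0; 0; 0; 3; 0; 0; 0; -6; 0] => x y z t.
by rewrite /a4_sextic /a4_sum /monomial4 /vandermonde4 /=; field.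
Qed.

Let orbit2220 : span_orbit 2 2 2 0.
Proof.
exists [:: 0; 0; 0; 0; 0; 0; 0; 3; -6; 0] => x y z t.
by rewrite /a4_sextic /a4_sum /monomial4 /vandermonde4 /=; field.
Qed.

Let orbit2211 : span_orbit 2 2 1 1.
Proof.
exists [:: 0; 0; 0; 0; 0; 0; 0; 0; 2; 0] => x y z t.
by rewrite /a4_sextic /a4_sum /monomial4 /vandermonde4 /=; field.
Qed.

Ltac orbit_representative :=
  idtac; match goal with
  | |- span_orbit 6 0 0 0 => exact: orbit6000
  | |- span_orbit 5 1 0 0 => exact: orbit5100
  | |- span_orbit 4 2 0 0 => exact: orbit4200
  | |- span_orbit 4 1 1 0 => exact: orbit4110
  | |- span_orbit 3 3 0 0 => exact: orbit3300
  | |- span_orbit 3 2 1 0 => exact: orbit3210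
  | |- span_orbit 2 3 1 0 => exact: orbit2310
  | |- span_orbit 3 1 1 1 => exact: orbit3111
  | |- span_orbit 2 2 2 0 => exact: orbit2220
  | |- span_orbit 2 2 1 1 => exact: orbit2211
  end.

Ltac up_to_yzt tac :=
  first [tac
       | apply: span_orbit_yzt; first [tac | apply: span_orbit_yzt; tac]].
Ltac up_to_xyz tac :=
  first [tac
       | apply: span_orbit_xyz; first [tac | apply: span_orbit_xyz; tac]].

Lemma span_orbit6 a b c d : (a + b + c + d = 6)%N -> span_orbit a b c d.
Proof.
case: a => [|[|[|[|[|[|[|a]]]]]]]; case: b => [|[|[|[|[|[|[|b]]]]]]] //;
  case: c => [|[|[|[|[|[|[|c]]]]]]] //; try lia;
  case: d => [|[|[|[|[|[|[|d]]]]]]] //; try lia; move=> _;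
  (* The alternating group is doubly transitive on the four positions, so each even permutation is a
     power of the cycle on y, z, t, times a power of the cycle on x, y, z, times another power of
     the first. *)
  up_to_yzt ltac:(up_to_xyz ltac:(up_to_yzt orbit_representative)).
Qed.

Variable p : K -> K -> K -> K -> K.
Hypothesis signx : forall x y z t, p (- x) y z t = p x y z t.
Hypothesis signy : forall x y z t, p x (- y) z t = p x y z t.
Hypothesis signz : forall x y z t, p x y (- z) t = p x y z t.
Hypothesis signt : forall x y z t, p x y z (- t) = p x y z t.
Hypothesis cycle_xyz : forall x y z t, p x y z t = p y z x t.
Hypothesis cycle_yzt : forall x y z t, p x y z t = p x z t y.

Lemma half_sum (u v : K) : u = v -> u = (u + v) / 2.
Proof. by move=> <-; field. Qed.

Let ev n x : K := (~~ odd n)%:R * (x ^+ 2) ^+ n./2.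

Let even_part_exp n x : (x ^+ n + (- x) ^+ n) / 2 = ev n x.
Proof.
rewrite /ev exprNn -signr_odd -exprM mul2n -[X in x ^+ X]odd_double_half.
by case: (odd n) => /=; rewrite ?add0n ?expr0 ?expr1 ?mul1r; field.
Qed.

Variables (I : eqType) (s : seq I) (k : I -> K) (a b c d : I -> nat).
Hypothesis deg12 : {in s, forall i, a i + b i + c i + d i = 12}%N.
Hypothesis pE : forall x y z t,
  p x y z t = \sum_(i <- s) k i * monomial4 (a i) (b i) (c i) (d i) x y z t.

Let even i := [&& ~~ odd (a i), ~~ odd (b i), ~~ odd (c i) & ~~ odd (d i)].

(** Averaging over the sign change of [x] kills the monomials of odd degree in [x]; the next three
    statements treat the other variables in turn. *)
Let p_evenx x y z t : p x y z t =
  \sum_(i <- s) k i * (ev (a i) x * y ^+ b i * z ^+ c i * t ^+ d i).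
Proof.
rewrite (half_sum (esym (signx x y z t))) !pE -big_split mulr_suml.
apply: eq_bigr => i _; rewrite -(even_part_exp (a i)) /monomial4 /=.
by move: ((- x) ^+ _) (x ^+ a i) => u v; field.
Qed.

Let p_evenxy x y z t : p x y z t =
  \sum_(i <- s) k i * (ev (a i) x * ev (b i) y * z ^+ c i * t ^+ d i).
Proof.
rewrite (half_sum (esym (signy x y z t))) !p_evenx -big_split mulr_suml.
apply: eq_bigr => i _; rewrite -(even_part_exp (b i)) /monomial4 /=.
by move: ((- y) ^+ _) (y ^+ b i) => u v; field.
Qed.

Let p_evenxyz x y z t : p x y z t =
  \sum_(i <- s) k i * (ev (a i) x * ev (b i) y * ev (c i) z * t ^+ d i).
Proof.
rewrite (half_sum (esym (signz x y z t))) !p_evenxy -big_split mulr_suml.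
apply: eq_bigr => i _; rewrite -(even_part_exp (c i)) /monomial4 /=.
by move: ((- z) ^+ _) (z ^+ c i) => u v; field.
Qed.

Let p_evenxyzt x y z t : p x y z t =
  \sum_(i <- s) k i * (ev (a i) x * ev (b i) y * ev (c i) z * ev (d i) t).
Proof.
rewrite (half_sum (esym (signt x y z t))) !p_evenxyz -big_split mulr_suml.
apply: eq_bigr => i _; rewrite -(even_part_exp (d i)) /monomial4 /=.
by move: ((- t) ^+ _) (t ^+ d i) => u v; field.
Qed.

(** After the odd exponents are removed, averaging over the twelve even permutations replaces each
    monomial in the squares by its orbit sum, a sextic covered by [span_orbit6]. *)
Lemma invariant_a4_span :
  exists2 q, a4_span q &
    forall x y z t, p x y z t = q (x ^+ 2) (y ^+ 2) (z ^+ 2) (t ^+ 2).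
Proof.
pose h i := a4_sum (monomial4 (a i)./2 (b i)./2 (c i)./2 (d i)./2).
exists (fun x y z t =>
    \sum_(i <- s | (i \in s) && even i) k i / 12 * h i x y z t).
  apply: a4_span_sum => i /andP[/deg12 + /and4P[ea eb ec ed]] => deg12i.
  apply: a4_spanZ; apply: span_orbit6.
  by move: ea eb ec ed deg12i; lia.
have pE2 x y z t : p x y z t = \sum_(i <- s | even i) k i *
    monomial4 (a i)./2 (b i)./2 (c i)./2 (d i)./2
      (x ^+ 2) (y ^+ 2) (z ^+ 2) (t ^+ 2).
  rewrite p_evenxyzt [RHS]big_mkcond; apply: eq_bigr => i _.
  rewrite /ev /even /monomial4.
  by do 4 ?case: (odd _) => /=; ring.
move=> x y z t.
have v4 x' y' z' t' : p x' y' z' t' = p y' x' t' z'.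
  by rewrite cycle_xyz cycle_yzt.
have v4' x' y' z' t' : p x' y' z' t' = p z' t' x' y'.
  by rewrite cycle_xyz cycle_xyz cycle_yzt cycle_yzt.
have c3 x' y' z' t' :
    p x' y' z' t' + p x' z' t' y' + p x' t' y' z' = 3 * p x' y' z' t'.
  by rewrite -(cycle_yzt x' y') (cycle_yzt x' t') -cycle_yzt; ring.
(* The double transpositions [v4] and [v4'] link the four blocks of three terms in [a4_sum], and
   [c3] collapses each block. *)
have -> : p x y z t = a4_sum p x y z t / 12.
  by rewrite /a4_sum !c3 -(v4 x) -(v4' x) -(v4 z) -(v4' x); field.
rewrite /a4_sum !pE2 -!big_split mulr_suml big_seq_cond /=; apply: eq_bigr => i
  _.
by rewrite /h /a4_sum; field.
Qed.

End AlternatingForms.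

(* The coefficients, in the sense of [a4_sextic], of a second invariant besides
   the power of the quadratic form. *)
Definition dodecic_coeffs (K : numFieldType) (s5 : K) : seq K :=
  [:: 0; 2; - 2; - 14; 365; - 7; 30; 21; - 1080; - 33 * s5].

(** Invariance under the remaining reflection is a linear system in the ten coefficients. The
    coefficient of index 0 stays free, because the sum of the squares is preserved by the
    reflection; the others turn out to be multiples of the coefficient of index 1. *)
Lemma a4_span_reflection (K : numFieldType) (s5 : K) (s5E : s5 * s5 = 5)
    (p q : K -> K -> K -> K -> K) :
  refl_invariant p ((1 + s5) / 2 / 2) (- 1 / 2) (- ((s5 - 1) / 2) / 2) 0 ->
  a4_span q ->
  (forall x y z t, p x y z t = q (x ^+ 2) (y ^+ 2) (z ^+ 2) (t ^+ 2)) ->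
  exists al be, forall x y z t, q x y z t =
    al * a4_sextic (dodecic_coeffs s5) x y z t + be * (x + y + z + t) ^+ 6.
Proof.
move=> p3 [k qE] pE.
(* The squares are separate arguments so that each equation can be stated with evaluated numbers. *)
have pt x y z t x1 y1 z1 t1 x2 y2 z2 t2 :
  let r := 2 * ((1 + s5) / 2 / 2 * x + (- 1 / 2) * y + - ((s5 - 1) / 2) / 2 * z
    + 0 * t) in
  x1 = x ^+ 2 -> y1 = y ^+ 2 -> z1 = z ^+ 2 -> t1 = t ^+ 2 ->
  x2 = (x - r * ((1 + s5) / 2 / 2)) ^+ 2 -> y2 = (y - r * (- 1 / 2)) ^+ 2 ->
  z2 = (z - r * (- ((s5 - 1) / 2) / 2)) ^+ 2 -> t2 = (t - r * 0) ^+ 2 ->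
  a4_sextic k x1 y1 z1 t1 - a4_sextic k x2 y2 z2 t2 = 0.
  by move=> r -> -> -> -> -> -> -> ->; rewrite -!qE -!pE p3 subrr.
(* Each equation compares the values at a point and at its mirror image; the
   weights given to [comb6] are rows of the inverse of the linear system. *)
have E0 : 162 * k`_1 + 27 * k`_2 + 72 * k`_3 + 9 * k`_5 + 26 * k`_6 + 1 * k`_7 =
  0.
  have E : a4_sextic k 0 (3 / 2 + (1 / 2) * s5) (3 / 2 + (- 1 / 2) * s5) 0 -
    a4_sextic k 1 1 1 0 = 0.
    by apply: (@pt 0 (1 / 2 + (1 / 2) * s5) (1 / 2 + (- 1 / 2) * s5) 0); field:
      s5E.
  rewrite -[RHS](mulr0 (- 1)) -[X in _ = _ * X]E /a4_sextic /vandermonde4.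
  by field: s5E.
have E1 : 1024 * k`_1 + 64 * k`_2 + 256 * k`_3 + 16 * k`_5 + 64 * k`_6 + 1 *
  k`_7 + 1 * (s5 * k`_9) = 0.
  have E : a4_sextic k 0 0 1 0 - a4_sextic k (1 / 4) (3 / 8 + (- 1 / 8) * s5) (3
    / 8 + (1 / 8) * s5) 0 = 0.
    by apply: (@pt 0 0 1 0); field: s5E.
  rewrite -[RHS](mulr0 (- (1024 * 4))) -[X in _ = _ * X]E /a4_sextic
    /vandermonde4.
  by field: s5E.
have E2 : (1024 * 4) * k`_1 + 256 * k`_2 + 1536 * k`_3 + 72 * k`_5 + 448 * k`_6
  + 3 * k`_7 + (- 5) * (s5 * k`_9) = 0.
  have E : a4_sextic k 1 (7 / 2 + (3 / 2) * s5) (7 / 2 + (- 3 / 2) * s5) 0 -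
    a4_sextic k (3 / 2 + (1 / 2) * s5) 5 (3 / 2 + (- 1 / 2) * s5) 0 = 0.
    by apply: (@pt 1 (3 / 2 + (1 / 2) * s5) (- 3 / 2 + (1 / 2) * s5) 0); field:
      s5E.
  rewrite -[RHS](mulr0 (- 1 / 8)) -[X in _ = _ * X]E /a4_sextic /vandermonde4.
  by field: s5E.
have E3 : (686 * 7) * k`_1 + 343 * k`_2 + 1176 * k`_3 + 77 * k`_5 + 266 * k`_6 +
  5 * k`_7 = 0.
  have E : a4_sextic k 0 (7 / 2 + (- 3 / 2) * s5) (7 / 2 + (3 / 2) * s5) 0 -
    a4_sextic k 1 1 5 0 = 0.
    by apply: (@pt 0 (- 3 / 2 + (1 / 2) * s5) (3 / 2 + (1 / 2) * s5) 0); field: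
      s5E.
  rewrite -[RHS](mulr0 (- 1 / 5)) -[X in _ = _ * X]E /a4_sextic /vandermonde4.
  by field: s5E.
have E4 : (686 * 7) * k`_1 + (- 343) * k`_2 + (336 * 7) * k`_3 + (- 21) * k`_5 +
  866 * k`_6 + (- 9) * k`_7 + 20 * (s5 * k`_9) = 0.
  have E : a4_sextic k 4 (3 / 2 + (1 / 2) * s5) (3 / 2 + (- 1 / 2) * s5) 0 -
    a4_sextic k 1 5 1 0 = 0.
    by apply: (@pt 2 (1 / 2 + (1 / 2) * s5) (- 1 / 2 + (1 / 2) * s5) 0); field:
      s5E.
  rewrite -[RHS](mulr0 1) -[X in _ = _ * X]E /a4_sextic /vandermonde4.
  by field: s5E.
have E5 : (1024 * 27) * k`_1 + 1728 * k`_2 + (768 * 11) * k`_3 + 336 * k`_5 +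
  1984 * k`_6 + 9 * k`_7 + (- 55) * (s5 * k`_9) = 0.
  have E : a4_sextic k 0 (3 / 2 + (- 1 / 2) * s5) (3 / 2 + (1 / 2) * s5) 0 -
    a4_sextic k (3 / 8 + (- 1 / 8) * s5) (3 / 8 + (1 / 8) * s5) (9 / 4) 0 = 0.
    by apply: (@pt 0 (- 1 / 2 + (1 / 2) * s5) (- 1 / 2 + (- 1 / 2) * s5) 0);
      field: s5E.
  rewrite -[RHS](mulr0 (- (1024 * 4) / 9)) -[X in _ = _ * X]E /a4_sextic
    /vandermonde4.
  by field: s5E.
(* The previous points have [t = 0], which kills the terms with the product of all four variables,
   those of index 4 and 8. These two coefficients enter only now, with [t = 1]. *)
have E6 : 512 * k`_1 + 192 * k`_2 + 320 * k`_3 + 16 * k`_4 + 80 * k`_5 + 152 *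
  k`_6 + 15 * k`_7 + 6 * k`_8 + (- 1) * (s5 * k`_9) = 0.
  have E : a4_sextic k 0 (3 / 2 + (1 / 2) * s5) (3 / 2 + (- 1 / 2) * s5) 1 -
    a4_sextic k 1 1 1 1 = 0.
    by apply: (@pt 0 (1 / 2 + (1 / 2) * s5) (1 / 2 + (- 1 / 2) * s5) 1); field:
      s5E.
  rewrite -[RHS](mulr0 (- 1)) -[X in _ = _ * X]E /a4_sextic /vandermonde4.
  by field: s5E.
have E7 : 1728 * k`_2 + 576 * k`_4 + 576 * k`_5 + 133 * k`_7 + 192 * k`_8 + (-
  11) * (s5 * k`_9) = 0.
  have E : a4_sextic k 0 1 1 1 - a4_sextic k (3 / 8 + (- 1 / 8) * s5) (3 / 8 +
    (1 / 8) * s5) (5 / 4) 1 = 0.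
    by apply: (@pt 0 1 (- 1) 1); field: s5E.
  rewrite -[RHS](mulr0 (- (1024 * 4) / 5)) -[X in _ = _ * X]E /a4_sextic
    /vandermonde4.
  by field: s5E.
have comb6 c0 c1 c2 c3 c4 c5 : - (c0 * (162 * k`_1 + 27 * k`_2 + 72 * k`_3 + 9 *
  k`_5 + 26 * k`_6 + 1 * k`_7) + c1 * (1024 * k`_1 + 64 * k`_2 + 256 * k`_3 + 16
  * k`_5 + 64 * k`_6 + 1 * k`_7 + 1 * (s5 * k`_9)) + c2 * ((1024 * 4) * k`_1 +
  256 * k`_2 + 1536 * k`_3 + 72 * k`_5 + 448 * k`_6 + 3 * k`_7 + (- 5) * (s5 *
  k`_9)) + c3 * ((686 * 7) * k`_1 + 343 * k`_2 + 1176 * k`_3 + 77 * k`_5 + 266 *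
  k`_6 + 5 * k`_7) + c4 * ((686 * 7) * k`_1 + (- 343) * k`_2 + (336 * 7) * k`_3
  + (- 21) * k`_5 + 866 * k`_6 + (- 9) * k`_7 + 20 * (s5 * k`_9)) + c5 * ((1024
  * 27) * k`_1 + 1728 * k`_2 + (768 * 11) * k`_3 + 336 * k`_5 + 1984 * k`_6 + 9
  * k`_7 + (- 55) * (s5 * k`_9))) = 0.
  by rewrite E0 E1 E2 E3 E4 E5 !mulr0 !addr0 oppr0.
have K2 : k`_2 = (- 1) * k`_1.
  rewrite -[LHS]addr0 -[X in _ + X = _](comb6 (47 / 160) (195 / 128) (- 17 /
    240) (- 13 / 32) (- 1 / 48) (17 / 640));
    by field: s5E.
have K3 : k`_3 = (- 7) * k`_1.
  rewrite -[LHS]addr0 -[X in _ + X = _](comb6 (- 21 / 320) (- 13 / 32) (1 / 80)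
    (7 / 64) (1 / 160) (- 1 / 160));
    by field: s5E.
have K5 : k`_5 = (- 7 / 2) * k`_1.
  rewrite -[LHS]addr0 -[X in _ + X = _](comb6 (- 105 / 64) (- 1515 / 256) (187 /
    480) (103 / 64) (31 / 480) (- 153 / 1280));
    by field: s5E.
have K6 : k`_6 = 15 * k`_1.
  rewrite -[LHS]addr0 -[X in _ + X = _](comb6 (47 / 160) (3 / 2) (- 7 / 120) (-
    13 / 32) (- 1 / 48) (1 / 40));
    by field: s5E.
have K7 : k`_7 = (21 / 2) * k`_1.
  rewrite -[LHS]addr0 -[X in _ + X = _](comb6 (315 / 64) (609 / 256) (- 469 /
    480) (- 53 / 64) (7 / 96) (203 / 1280));
    by field: s5E.
have K9 : k`_9 = - 33 * s5 * (k`_1 / 2).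
  have := comb6 (169 / 320) (975 / 256) (- 91 / 480) (- 59 / 64) (- 19 / 480)
    (69 / 1280) => U.
  (* The system determines [s5] times the last coefficient; the factor [s5 / 5] is the inverse of
     [s5]. *)
  rewrite -[LHS]addr0 -[X in _ + X = _](mulr0 (s5 / 5)) -[X in _ + _ * X = _]U;
    by field: s5E.
have K4 : k`_4 = 365 / 2 * k`_1.
  apply: subr0_eq; rewrite -[RHS](subrr ((- 1 / 2) * 0)) -[X in _ = _ * X -
    _]E6.
  rewrite -[X in _ = _ - _ * X](mulr0 (1 / 32)) -[X in _ = _ - _ * (_ * X)]E7.
  by rewrite K2 K3 K5 K6 K7 K9; field: s5E.
have K8 : k`_8 = - 540 * k`_1.
  apply: subr0_eq; rewrite -[RHS](subrr (3 / 2 * 0)) -[X in _ = _ * X - _]E6.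
  rewrite -[X in _ = _ - _ * X](mulr0 (1 / 36)) -[X in _ = _ - _ * (_ * X)]E7.
  by rewrite K2 K3 K5 K6 K7 K9; field: s5E.
exists (k`_1 / 2), k`_0 => x y z t; rewrite qE /a4_sextic /=.
by rewrite K2 K3 K4 K5 K6 K7 K8 K9; field.
Qed.

(** * Points of multiplicity at least two and multiple roots of binary forms *)

Section Flatness.

Variable K : numFieldType.
Implicit Types (p : K -> K -> K -> K -> K) (x y z t : K).

Lemma horner_inj (p q : {poly K}) : (forall x, p.[x] = q.[x]) -> p = q.
Proof.
move=> pq; apply/eqP; rewrite -subr_eq0; apply/eqP.
pose rs : seq K := [seq i%:R | i <- iota 0 (size (p - q))].
apply: (@roots_geq_poly_eq0 _ _ rs); last by rewrite size_map size_iota.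
  by apply/allP => x _; rewrite /root !hornerE pq subrr.
by rewrite map_inj_uniq ?iota_uniq // => i j /eqP; rewrite eqr_nat => /eqP.
Qed.

(* For a polynomial [p]: it vanishes at the point together with its gradient. *)
Definition flat p x y z t : Prop :=
  forall x' y' z' t', exists h : {poly K}, forall u,
    p (x + u * x') (y + u * y') (z + u * z') (t + u * t') = u ^+ 2 * h.[u].

Lemma flat_ext p q x y z t : (forall x y z t, p x y z t = q x y z t) ->
  flat p x y z t -> flat q x y z t.
Proof.
move=> pq H x' y' z' t'; have [h Hh] := H x' y' z' t'.
by exists h => u; rewrite -pq.
Qed.

Definition binary_form (c : seq K) (s t : K) : K :=
  c`_0 * s ^+ 12 + c`_1 * (s ^+ 9 * t ^+ 3) + c`_2 * (s ^+ 6 * t ^+ 6)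
  + c`_3 * (s ^+ 3 * t ^+ 9) + c`_4 * t ^+ 12.

(** The factor [u ^+ 2] makes the derivative in [u] vanish at 0, and this derivative is the partial
    derivative of the form in its first variable. *)
Lemma binary_form_double_root c s t (h : {poly K}) :
  (forall u, binary_form c (s + u) t = u ^+ 2 * h.[u]) ->
  12 * c`_0 * s ^+ 11 + 9 * c`_1 * (s ^+ 8 * t ^+ 3)
  + 6 * c`_2 * (s ^+ 5 * t ^+ 6) + 3 * c`_3 * (s ^+ 2 * t ^+ 9) = 0.
Proof.
move=> H; pose v : {poly K} := s%:P + 'X.
pose q := c`_0 *: v ^+ 12 + (c`_1 * t ^+ 3) *: v ^+ 9
  + (c`_2 * t ^+ 6) *: v ^+ 6 + (c`_3 * t ^+ 9) *: v ^+ 3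
  + (c`_4 * t ^+ 12)%:P.
have : q = 'X^2 * h.
  apply: horner_inj => u.
  by rewrite /q /v !hornerE -H /binary_form /=; ring.
move=> /(congr1 (fun r => r^`().[0])).
have dv n : (v ^+ n)^`().[0] = n%:R * s ^+ n.-1.
  by rewrite /v deriv_exp !derivE add0r mul1r hornerMn horner_exp hornerD
    hornerC hornerX addr0 mulr_natl.
have -> : ('X^2 * h)^`().[0] = 0.
  by rewrite expr2 !derivM derivX !hornerE; ring.
rewrite /q !derivD !derivZ derivC !hornerD !hornerZ !dv hornerC => E.
by rewrite -[RHS]E /=; ring.
Qed.

(* The two equations are the partial derivatives of the form [binary_form] with
   coefficients [k ^+ 2 * a], [k * b], [c], [b], [a], which is palindromic up to
   the scaling of [s ^+ 3] by a square root of [k]. *)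
Lemma singular_binary_form (a b c k s t : K) : a != 0 -> k != 0 ->
  ~~ ((s == 0) && (t == 0)) ->
  12 * (k ^+ 2 * a) * s ^+ 11 + 9 * (k * b) * (s ^+ 8 * t ^+ 3)
    + 6 * c * (s ^+ 5 * t ^+ 6) + 3 * b * (s ^+ 2 * t ^+ 9) = 0 ->
  12 * a * t ^+ 11 + 9 * b * (t ^+ 8 * s ^+ 3)
    + 6 * c * (t ^+ 5 * s ^+ 6) + 3 * (k * b) * (t ^+ 2 * s ^+ 9) = 0 ->
  (2 * a * k + c) ^+ 2 = 4 * b ^+ 2 * k \/ 4 * a * c = 8 * a ^+ 2 * k + b ^+ 2.
Proof.
move=> a0 k0 st0 H1 H2.
have n12 : 12%:R != 0 :> K by rewrite pnatr_eq0.
have s0 : s != 0.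
  apply: contraNneq st0 => s0; rewrite s0 eqxx /=.
  suff : t ^+ 11 == 0 by rewrite expf_eq0.
  apply/eqP/(mulfI (mulf_neq0 n12 a0)); rewrite mulr0 -H2 s0; ring.
have t0 : t != 0.
  apply: contraNneq st0 => t0; rewrite t0 eqxx andbT.
  suff : s ^+ 11 == 0 by rewrite expf_eq0.
  apply/eqP/(mulfI (mulf_neq0 n12 (mulf_neq0 (expf_neq0 2 k0) a0))).
  by rewrite mulr0 -H1 t0; ring.
have {}H1 : 4 * k ^+ 2 * a * (s ^+ 3) ^+ 3 + 3 * k * b * (s ^+ 3) ^+ 2 * t ^+ 3
    + 2 * c * s ^+ 3 * (t ^+ 3) ^+ 2 + b * (t ^+ 3) ^+ 3 = 0.
  by apply: (mulfI (_ : 3 * s ^+ 2 != 0));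
    rewrite ?mulf_neq0 ?expf_neq0 ?pnatr_eq0 // mulr0 -H1; ring.
have {}H2 : 4 * a * (t ^+ 3) ^+ 3 + 3 * b * (t ^+ 3) ^+ 2 * s ^+ 3
    + 2 * c * t ^+ 3 * (s ^+ 3) ^+ 2 + k * b * (s ^+ 3) ^+ 3 = 0.
  by apply: (mulfI (_ : 3 * t ^+ 2 != 0));
    rewrite ?mulf_neq0 ?expf_neq0 ?pnatr_eq0 // mulr0 -H2; ring.
move: (s ^+ 3) (t ^+ 3) (expf_neq0 3 s0) (expf_neq0 3 t0) H1 H2.
move=> X Y X0 Y0 H1 H2.
(* The terms in [c] cancel in [X * H1 - Y * H2]. In terms of m = k X / Y + Y / X the form is X^2 Y^2
   (a m^2 + b m + c - 2 a k): the first factor describes the ramification points of m, the second a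
   double root of the quadratic in m. *)
have : (k * X ^+ 2 - Y ^+ 2) * (2 * a * (k * X ^+ 2 + Y ^+ 2) + b * X * Y) == 0.
  apply/eqP/(mulfI (_ : 2 != 0)); first by rewrite pnatr_eq0.
  transitivity (X * 0 - Y * 0); last by rewrite !mulr0 subrr.
  by rewrite -[Z in _ = _ * Z - _]H1 -[Z in _ = _ - _ * Z]H2; ring.
rewrite mulf_eq0 => /orP[/eqP/subr0_eq kX|/eqP kX]; [left|right].
  have E : (2 * a * k + c) * X = - (2 * b) * Y.
    apply: (mulIf (_ : 2 * X * Y != 0)); first by rewrite !mulf_neq0 ?pnatr_eq0.
    by apply: subr0_eq; rewrite -[RHS]H2; ring: kX.
  apply: (mulIf (expf_neq0 2 X0)); rewrite -exprMn E.
  by rewrite exprMn -kX; ring.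
apply: (mulIf (_ : 2 * X ^+ 2 * Y ^+ 2 != 0)).
  by rewrite !mulf_neq0 ?expf_neq0 ?pnatr_eq0.
have bXY : b * X * Y = - 2 * a * (k * X ^+ 2 + Y ^+ 2).
  by apply: subr0_eq; rewrite -[RHS]kX; ring.
by apply: subr0_eq; rewrite -[RHS](mulr0 (4 * a * X)) -H1; ring: bXY.
Qed.

End Flatness.

(** * Restriction of the pencil to the planes spanned by two common eigenvectors *)

Section CriticalValues.

Variables (K : numFieldType) (s5 th al be : K).
Hypothesis s5E : s5 * s5 = 5.
Hypothesis thE : th * th = - 3.
Local Notation w := ((- 1 + th) / 2).
Local Notation w2 := ((- 1 - th) / 2).
Local Notation r := (s5 * th).

Definition h4_form x y z t : K :=
  al * a4_sextic (dodecic_coeffs s5) (x ^+ 2) (y ^+ 2) (z ^+ 2) (t ^+ 2)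
  + be * (x ^+ 2 + y ^+ 2 + z ^+ 2 + t ^+ 2) ^+ 6.

(* Eigenvectors of the two commuting rotations of order 3:
   0 is [(th, 1, 1, 1)], 1 is [(- th, 1, 1, 1)], 2 is [(0, 1, w, w2)] and 3 is
   [(0, 1, w2, w)]; the names of the lemmas refer to these numbers. *)
Lemma h4_form_plane01 s t :
  h4_form (th * s + - th * t) (s + t) (s + t) (s + t) =
  binary_form (let a := - 384 * 64 * al in let b := 1056 * 64 * al in
    [:: a; b; 2880 * 64 * al + 12 ^+ 6 * be; b; a]) s t.
Proof.
have -> : th * s + - th * t = th * (s - t) by ring.
rewrite /h4_form /a4_sextic /vandermonde4 /binary_form /= exprMn [th ^+ 2]expr2
  thE.
ring.
Qed.

Lemma h4_form_plane23 s t :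
  h4_form 0 (s + t) (w * s + w2 * t) (w2 * s + w * t) =
  binary_form [:: (21 - 99 * r) * al; (- 726 - 198 * r) * al;
    2880 * al + 6 ^+ 6 * be; (- 726 + 198 * r) * al; (21 + 99 * r) * al] s t.
Proof.
rewrite /h4_form /a4_sextic /vandermonde4 /binary_form /=.
by field: s5E thE.
Qed.

Lemma h4_form_plane02 e s t : e ^+ 2 = - 3 ->
  h4_form (e * s) (s + t) (s + w * t) (s + w2 * t) =
  binary_form [:: - 384 * 64 * al; (- 1320 + 792 * r) * 64 * al;
    (- 4356 - 1188 * r) * 16 * al; (- 6270 + 594 * r) * 4 * al;
    (21 - 99 * r) * al] s t.
Proof.
move=> eE; rewrite /h4_form exprMn eE.
rewrite /a4_sextic /vandermonde4 /binary_form /=.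
by field: s5E thE.
Qed.

Lemma flat_plane p c (u0 u1 u2 u3 v0 v1 v2 v3 s t : K) :
  (forall s t, p (u0 * s + v0 * t) (u1 * s + v1 * t) (u2 * s + v2 * t)
    (u3 * s + v3 * t) = binary_form c s t) ->
  flat p (u0 * s + v0 * t) (u1 * s + v1 * t) (u2 * s + v2 * t)
    (u3 * s + v3 * t) ->
  12 * c`_0 * s ^+ 11 + 9 * c`_1 * (s ^+ 8 * t ^+ 3)
    + 6 * c`_2 * (s ^+ 5 * t ^+ 6) + 3 * c`_3 * (s ^+ 2 * t ^+ 9) = 0 /\
  12 * c`_4 * t ^+ 11 + 9 * c`_3 * (t ^+ 8 * s ^+ 3)
    + 6 * c`_2 * (t ^+ 5 * s ^+ 6) + 3 * c`_1 * (t ^+ 2 * s ^+ 9) = 0.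
Proof.
move=> pE pflat; split.
  have [h H] := pflat u0 u1 u2 u3; apply: (@binary_form_double_root _ c s t h).
  by move=> u; rewrite -pE -H; congr p; ring.
have [h H] := pflat v0 v1 v2 v3.
have /= := @binary_form_double_root _ [:: c`_4; c`_3; c`_2; c`_1; c`_0] t s h.
apply=> u; rewrite -H.
transitivity (binary_form c s (t + u)); first by rewrite /binary_form /=; ring.
by rewrite -pE; congr p; ring.
Qed.

Definition critical : Prop :=
  [\/ be = 0, be = - (22 / 243) * al | be = - (3 / 32) * al].

(** Up to a factor [k] in the second one, both criteria of [singular_binary_form] depend only on
    [a * k], [b ^+ 2 * k] and [c]. These quantities agree for the planes 01 and 23, so both planes
    give the same three critical values. *)
Lemma criticalP (a b k c : K) : al != 0 -> k != 0 ->
  a * k = - 384 * al -> b ^+ 2 * k = 1056 * 1056 * al ^+ 2 ->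
  c = 2880 * al + 6 ^+ 6 * be ->
  (2 * a * k + c) ^+ 2 = 4 * b ^+ 2 * k \/ 4 * a * c = 8 * a ^+ 2 * k + b ^+ 2
    ->
  critical.
Proof.
set c' := 2880 * al + _ => al0 k0 ak bk -> [H|H].
  have : be * (243 * be + 22 * al) == 0.
    apply/eqP/(mulfI (_ : 6 ^+ 6 * 192 != 0)).
      by rewrite mulf_neq0 ?expf_neq0 ?pnatr_eq0.
    rewrite mulr0 -[RHS](subrr (4 * b ^+ 2 * k)) -[Z in _ = Z - _]H.
    rewrite (_ : 4 * b ^+ 2 * k = 4 * (b ^+ 2 * k)); last by ring.
    by rewrite bk /c'; ring: ak.
  rewrite mulf_eq0 => /orP[/eqP E|/eqP E]; first by constructor 1.
  constructor 2; apply: subr0_eq.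
  by rewrite -[RHS](mulr0 (1 / 243)) -[Z in _ = _ * Z]E; field.
constructor 3; apply: subr0_eq.
apply: (mulfI (_ : - 1536 * 6 ^+ 6 * al != 0)).
  by rewrite !mulf_neq0 ?expf_neq0 ?oppr_eq0 ?pnatr_eq0.
have {}H : 4 * (a * k) * c' = 8 * (a * k) ^+ 2 + b ^+ 2 * k.
  by transitivity (k * (4 * a * c')); [ring | rewrite H; ring].
move: H; rewrite ak bk /c' => H; rewrite mulr0 -[RHS](subrr (8 * (- 384 * al) ^+
  2 + 1056 * 1056 * al ^+ 2)).
rewrite -[Z in _ = Z - _]H.
by field.
Qed.

Let rE : r ^+ 2 = - 15.
Proof. by rewrite expr2 mulrACA s5E thE; ring. Qed.

(** Since [r] is a square root of -15, multiplication by the conjugate gives m^2 + 15 n^2, a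
    positive integer. *)
Let lin_neq0 (m n : nat) e :
  (m != 0%N) -> e ^+ 2 = 1 -> m%:R + e * n%:R * r != 0 :> K.
Proof.
move=> m0 eE; apply/eqP => E.
have : (m ^ 2 + n ^ 2 * 15)%:R == 0 :> K.
  rewrite natrD natrM !natrX.
  apply/eqP; rewrite -[RHS](mul0r (m%:R - e * n%:R * r)) -[Z in _ = Z * _]E.
  transitivity (m%:R ^+ 2 - e ^+ 2 * n%:R ^+ 2 * r ^+ 2); last by ring.
  by rewrite rE eE; ring.
by rewrite pnatr_eq0 addn_eq0 expn_eq0 (negPf m0).
Qed.

Lemma critical_plane01 s t : al != 0 -> ~~ ((s == 0) && (t == 0)) ->
  flat h4_form (th * s + - th * t) (1 * s + 1 * t) (1 * s + 1 * t)
    (1 * s + 1 * t) -> critical.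
Proof.
move=> al0 st0 /flat_plane.
move=> /(_ [:: - 384 * 64 * al; 1056 * 64 * al;
   2880 * 64 * al + 12 ^+ 6 * be; 1056 * 64 * al; - 384 * 64 * al]).
case=> [s' t'|]; first by rewrite !mul1r h4_form_plane01.
move=> /= H1 H2.
apply: (@criticalP (- 384 * al) (1056 * al) 1 _ al0 (oner_neq0 _) _ _ erefl);
  try by ring.
(* The common factor 64 of the coefficients is removed to reach the normalization of [criticalP];
   note that 12^6 = 64 * 6^6. *)
have n64 : 64%:R != 0 :> K by rewrite pnatr_eq0.
apply: (@singular_binary_form _ _ _ _ _ s t); rewrite ?oner_neq0 //.
- by rewrite mulf_neq0 ?oppr_eq0 ?pnatr_eq0.
- by apply: (mulfI n64); rewrite mulr0 -H1; ring.
- by apply: (mulfI n64); rewrite mulr0 -H2; ring.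
Qed.

Lemma critical_plane23 s t : al != 0 -> ~~ ((s == 0) && (t == 0)) ->
  flat h4_form (0 * s + 0 * t) (1 * s + 1 * t) (w * s + w2 * t)
    (w2 * s + w * t) -> critical.
Proof.
move=> al0 st0 /flat_plane.
move=> /(_ [:: (21 - 99 * r) * al; (- 726 - 198 * r) * al;
    2880 * al + 6 ^+ 6 * be; (- 726 + 198 * r) * al; (21 + 99 * r) * al]).
case=> [s' t'|]; first by rewrite !mul0r !mul1r addr0 h4_form_plane23.
have r1 : 11 - 3 * r != 0.
  by have := @lin_neq0 11 3 (- 1) isT; rewrite mulN1r mulNr; apply; ring.
have r2 : 11 + 3 * r != 0.
  by have := @lin_neq0 11 3 1 isT; rewrite mul1r; apply; ring.
have r3 : 21 + 99 * r != 0.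
  by have := @lin_neq0 21 99 1 isT; rewrite mul1r; apply; ring.
move=> /= H1 H2.
have rr : r * r = - 15 by rewrite -expr2.
(* The ratio of the coefficients of s^9 t^3 and s^3 t^9, as the shape required by
   [singular_binary_form] imposes. *)
pose k := (11 + 3 * r) / (11 - 3 * r).
have k0 : k != 0 by rewrite mulf_neq0 ?invr_neq0.
have kb : k * ((- 726 + 198 * r) * al) = (- 726 - 198 * r) * al.
  by rewrite /k; field: s5E thE.
have ka : ((21 + 99 * r) * al) * k = - 384 * al.
  by rewrite /k; field: s5E thE.
have kka : k ^+ 2 * ((21 + 99 * r) * al) = (21 - 99 * r) * al.
  by rewrite /k; field: s5E thE.
apply: (@criticalP ((21 + 99 * r) * al) ((- 726 + 198 * r) * al) k _ al0 k0 ka _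
  erefl).
  by rewrite /k; field: s5E thE.
apply: (@singular_binary_form _ _ _ _ _ s t) => //; rewrite ?kka ?kb //.
by rewrite mulf_neq0.
Qed.

(** The invariant quadratic form vanishes on this plane, so [be] does not enter. Each criterion of
    [singular_binary_form] would then force a nonzero multiple of [(14 - 66 * r) * al ^+ 2] to
    vanish. *)
Lemma flat_plane02 s t e : e ^+ 2 = - 3 -> al != 0 -> ~~ ((s == 0) && (t == 0))
  ->
  ~ flat h4_form (e * s + 0 * t) (1 * s + 1 * t) (1 * s + w * t)
    (1 * s + w2 * t).
Proof.
move=> eE al0 st0 /flat_plane.
move=> /(_ [:: - 384 * 64 * al; (- 1320 + 792 * r) * 64 * al;
    (- 4356 - 1188 * r) * 16 * al; (- 6270 + 594 * r) * 4 * al;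
    (21 - 99 * r) * al]).
case=> [s' t'|]; first by rewrite !mul0r !mul1r addr0 h4_form_plane02.
move=> /= H1 H2.
have r3 : 21 - 99 * r != 0.
  by have := @lin_neq0 21 99 (- 1) isT; rewrite mulN1r mulNr; apply; ring.
have r2 : 11 - 3 * r != 0.
  by have := @lin_neq0 11 3 (- 1) isT; rewrite mulN1r mulNr; apply; ring.
pose k := (11 - 3 * r) / 2.
have k0 : k != 0 by rewrite mulf_neq0 ?invr_neq0 ?pnatr_eq0.
have kb : k * ((- 6270 + 594 * r) * 4 * al) = (- 1320 + 792 * r) * 64 * al.
  by rewrite /k; field: s5E thE.
have kka : k ^+ 2 * ((21 - 99 * r) * al) = - 384 * 64 * al.
  by rewrite /k; field: s5E thE.
have r4 : (14 - 66 * r) * al ^+ 2 != 0.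
  rewrite mulf_neq0 ?expf_neq0 //.
  by have := @lin_neq0 14 66 (- 1) isT; rewrite mulN1r mulNr; apply; ring.
set a := (21 - 99 * r) * al in H2 kka.
set b := (- 6270 + 594 * r) * 4 * al in H1 H2 kb.
set c := (- 4356 - 1188 * r) * 16 * al in H1 H2.
have ak : a * k = - 192 * (11 + 3 * r) * al by rewrite /a /k; field: s5E thE.
have bk : b ^+ 2 * k = 320 * 264 * 264 * ((14 - 66 * r) * al ^+ 2).
  by rewrite /b /k; field: s5E thE.
have := @singular_binary_form _ a b c k s t (mulf_neq0 r3 al0) k0 st0.
rewrite kka kb => /(_ H1 H2)[H|H].
  have : 2 ^+ 12 * 45 * 729 * ((14 - 66 * r) * al ^+ 2) == 0.
    apply/eqP; rewrite -[RHS](subrr (4 * b ^+ 2 * k)) -[Z in _ = _ - Z]H.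
    rewrite (_ : 4 * b ^+ 2 * k = 4 * (b ^+ 2 * k)); last by ring.
    rewrite (_ : 2 * a * k = 2 * (a * k)); last by ring.
    by rewrite bk ak /c; ring: s5E thE.
  apply/negP/mulf_neq0; last exact: r4.
  by rewrite !mulf_neq0 ?expf_neq0 ?pnatr_eq0.
have {}H : 4 * (a * k) * c = 8 * (a * k) ^+ 2 + b ^+ 2 * k.
  by transitivity (k * (4 * a * c)); [ring | rewrite H; ring].
have : 2 ^+ 12 * 9 ^+ 4 * ((14 - 66 * r) * al ^+ 2) == 0.
  apply/eqP; rewrite -[RHS](subrr (8 * (a * k) ^+ 2 + b ^+ 2 * k)) -[Z in _ = _
    - Z]H.
  by rewrite bk ak /c; ring: s5E thE.
apply/negP/mulf_neq0; last exact: r4.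
by rewrite !mulf_neq0 ?expf_neq0 ?pnatr_eq0.
Qed.

End CriticalValues.

(** * Position of an eigenvector with respect to the four common eigenvectors *)

Section CommonEigenvectors.

Variables (K : numFieldType) (s5 th al be : K).
Hypothesis s5E : s5 * s5 = 5.
Hypothesis thE : th * th = - 3.
Hypothesis al0 : al != 0.
Local Notation w := ((- 1 + th) / 2).
Local Notation w2 := ((- 1 - th) / 2).
Local Notation F := (h4_form s5 al be).

Let th0 : th != 0.
Proof.
apply/eqP => E; move/eqP: thE; rewrite E mul0r eq_sym oppr_eq0.
by rewrite pnatr_eq0.
Qed.

Let w_w2 : w - w2 != 0.
Proof. by rewrite (_ : w - w2 = th) //; field. Qed.

Let w_1_w2_1 : (1 - w != 0) && (1 - w2 != 0).
Proof.
rewrite -negb_or -mulf_eq0 (_ : _ * _ = 3) ?pnatr_eq0 //.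
by field: thE.
Qed.

Let eigen_disj (c u v a b : K) :
  c * a = u * a -> c * b = v * b -> [|| u - v == 0, a == 0 | b == 0].
Proof.
move=> Ha Hb; rewrite -!mulf_eq0; apply/eqP.
transitivity ((u * a) * b - a * (v * b)); first by ring.
by rewrite -Ha -Hb; ring.
Qed.

(** The four eigenvalues are [w2 ^+ j], [w ^+ j], [w ^+ i], [w2 ^+ i], and no three of them coincide
    as [i] and [j] are not both 0. Hence two of the coordinates vanish, which leaves six planes,
    four of them excluded by [flat_plane02]. *)
Lemma critical_eigenvector (a0 a1 a2 a3 c : K) (i j : nat) :
  (i < 3)%N -> (j < 3)%N -> (0 < i + j)%N ->
  ~~ [&& a0 == 0, a1 == 0, a2 == 0 & a3 == 0] ->
  c * a0 = w2 ^+ j * a0 -> c * a1 = w ^+ j * a1 ->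
  c * a2 = w ^+ i * a2 -> c * a3 = w2 ^+ i * a3 ->
  flat F (th * a0 - th * a1) (a0 + a1 + a2 + a3)
    (a0 + a1 + w * a2 + w2 * a3) (a0 + a1 + w2 * a2 + w * a3) ->
  critical al be.
Proof.
move=> i3 j3 ij nz e0 e1 e2 e3.
have : [|| (a2 == 0) && (a3 == 0), (a0 == 0) && (a1 == 0),
           (a1 == 0) && (a3 == 0), (a1 == 0) && (a2 == 0),
           (a0 == 0) && (a3 == 0) | (a0 == 0) && (a2 == 0)].
  have := eigen_disj e0 e1; have := eigen_disj e2 e3.
  have := eigen_disj e0 e2; have := eigen_disj e1 e3.
  have := eigen_disj e0 e3; have := eigen_disj e1 e2.
  have ww : w ^+ 2 = w2 by field: thE.
  have ww2 : w2 ^+ 2 = w by field: thE.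
  have n1 : w2 - w != 0 by rewrite -opprB oppr_eq0.
  have /andP[w_1 n3] := w_1_w2_1.
  have n2 : w - 1 != 0 by rewrite -opprB oppr_eq0.
  have n4 : w2 - 1 != 0 by rewrite -opprB oppr_eq0.
  case: i i3 ij {e2 e3} => [|[|[|//]]] _; case: j j3 {e0 e1} => [|[|[|//]]] // _
    _;
  rewrite ?ww ?ww2 ?expr0 ?expr1 ?subrr ?eqxx ?(negPf w_w2) ?(negPf n1)
    ?(negPf n2) ?(negPf n3) ?(negPf n4) ?(negPf w_1) /=;
  by case: (a0 == 0); case: (a1 == 0); case: (a2 == 0); case: (a3 == 0).
case/orP => [/andP[/eqP z2 /eqP z3]|].
  rewrite z2 z3 => H; apply: (critical_plane01 thE (s := a0) (t := a1) al0).
    by move: nz; rewrite z2 z3 eqxx !andbT.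
  by move: H; rewrite !mulr0 !addr0 !mul1r -mulNr; apply.
case/orP => [/andP[/eqP z0 /eqP z1]|].
  rewrite z0 z1 => H; apply: (critical_plane23 s5E thE (s := a2) (t := a3) al0).
    by move: nz; rewrite z0 z1 eqxx.
  by move: H; rewrite !mulr0 !add0r !mul0r !mul1r ?oppr0 ?addr0; apply.
have plane e u v : e ^+ 2 = - 3 -> ~~ ((u == 0) && (v == 0)) ->
  ~ flat F (e * u) (u + v) (u + w * v) (u + w2 * v).
  move=> eE uv H; apply: (flat_plane02 s5E thE eE al0 uv).
  by rewrite mul0r addr0 !mul1r; apply: H.
(* Replacing [th] by [- th] exchanges [w] and [w2]. *)
have plane' e u v : e ^+ 2 = - 3 -> ~~ ((u == 0) && (v == 0)) ->
  ~ flat F (e * u) (u + v) (u + w2 * v) (u + w * v).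
  have thNE : - th * - th = - 3 by rewrite mulrNN.
  move=> eE uv H; apply: (flat_plane02 s5E thNE eE al0 uv).
  by rewrite mul0r addr0 !mul1r opprK; apply: H.
have e1E : th ^+ 2 = - 3 by rewrite expr2.
have e2E : (- th) ^+ 2 = - 3 by rewrite sqrrN.
case/or4P => /andP[/eqP z /eqP z']; move: nz;
  rewrite z z' ?eqxx ?mulr0 ?addr0 ?add0r ?subr0 ?sub0r ?andbT => nz H;
  exfalso; rewrite ?sub0r -?mulNr in H.
- by apply: plane H.
- by apply: plane' H.
- by apply: plane H.
- by apply: plane' H.
Qed.

End CommonEigenvectors.

(** Uniqueness of digits in base [N], which makes the Kronecker substitution injective on monomials;
    remainder and quotient by [N] split off the lowest digit. *)
Lemma digits_inj (N n : nat) (a b : 'I_n -> nat) :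
  (forall i, a i < N)%N -> (forall i, b i < N)%N ->
  (\sum_(i < n) a i * N ^ i = \sum_(i < n) b i * N ^ i)%N -> a =1 b.
Proof.
elim: n a b => [|n IHn] a b aN bN; first by move=> _ [].
have N0 : (0 < N)%N by apply: leq_trans (aN ord0).
have shift (c : 'I_n.+1 -> nat) : (\sum_(i < n.+1) c i * N ^ i =
    (\sum_(i < n) c (lift ord0 i) * N ^ i) * N + c ord0)%N.
  rewrite big_ord_recl expn0 muln1 addnC big_distrl; congr addn.
  by apply: eq_bigr => i _; rewrite /= -mulnA -expnSr.
rewrite !shift => E i.
have E0 : a ord0 = b ord0.
  by have := congr1 (modn^~ N) E; rewrite !modnMDl !modn_small.
have := congr1 (divn^~ N) E.
rewrite !divnMDl // !divn_small // !addn0 => /IHn E1.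
case: (unliftP ord0 i) => [j|] -> //.
by apply: E1.
Qed.

(** * Polynomials as functions: vanishing and first-order Taylor expansion *)

Section PolynomialFunctions.

Variables (K : numFieldType) (n : nat).
Implicit Types f g : {mpoly K[n]}.

(* Kronecker substitution reduces the claim to one variable. *)
Lemma meval_eq0 f : (forall v, f.@[v] = 0) -> f = 0.
Proof.
move=> f0; apply/mpolyP => m; rewrite mcoeff0.
(* The base exceeds every exponent in [f] and in [m]. *)
pose N := (msize f + mdeg m).+1.
pose key (m' : 'X_{1..n}) := (\sum_(i < n) m' i * N ^ i)%N.
pose P : {poly K} := \sum_(m' <- msupp f) f@_m' *: 'X^(key m').
have P0 : P = 0.
  apply: horner_inj => x; rewrite horner0 -(f0 (fun i => x ^+ (N ^ i))).
  rewrite mevalE horner_sum; apply: eq_bigr => m' _.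
  rewrite hornerZ hornerXn; congr (_ * _).
  by rewrite /key expr_sum; apply: eq_bigr => i _; rewrite mulnC exprM.
have le_mdeg (m' : 'X_{1..n}) i : (m' i <= mdeg m')%N.
  by rewrite mdegE (bigD1 i) //= leq_addr.
have mN i : (m i < N)%N.
  by rewrite ltnS; apply: leq_trans (le_mdeg m i) (leq_addl _ _).
have := congr1 (fun q : {poly K} => q`_(key m)) P0; rewrite coef0 coef_sum.
have key_inj m' : m' \in msupp f -> key m = key m' -> m = m'.
  move=> m'f; have m'N i : (m' i < N)%N.
    rewrite ltnS; apply: leq_trans (le_mdeg m' i) _.
    by apply: leq_trans (leq_addr _ _); apply/ltnW/msize_mdeg_lt.
  by move=> E; apply/mnmP; apply: (digits_inj mN m'N E).
case: (boolP (m \in msupp f)) => [mf|/memN_msupp_eq0 //].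
rewrite (bigD1_seq m) ?msupp_uniq //= coefZ coefXn eqxx mulr1 big_seq_cond.
rewrite big1 ?addr0 // => m' /andP[m'f ne]; rewrite coefZ coefXn.
case: eqP => [E|]; last by rewrite mulr0.
by rewrite (key_inj _ m'f E) eqxx in ne.
Qed.

Variables v d : 'I_n -> K.
Let D f := \sum_i d i * (f^`M(i)).@[v].
Let line u := fun i => v i + u * d i.

Let taylor_to f :=
  exists h : {poly K}, forall u, f.@[line u] = f.@[v] + u * D f + u ^+ 2 *
    h.[u].

Let taylorM f g : taylor_to f -> taylor_to g -> taylor_to (f * g).
Proof.
move=> [h Hh] [k Hk].
exists (h * (g.@[v]%:P + D g *: 'X + 'X^2 * k) + (f.@[v]%:P + D f *: 'X) * k
        + (D f * D g)%:P) => u.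
have -> : D (f * g) = D f * g.@[v] + f.@[v] * D g.
  rewrite /D big_distrl big_distrr -big_split; apply: eq_bigr => i _ /=.
  by rewrite mderivM mevalD !mevalM; ring.
by rewrite !mevalM Hh Hk !hornerE; ring.
Qed.

(** Constants and variables have such an expansion, and it is inherited by products and sums. *)
Lemma meval_taylor f : taylor_to f.
Proof.
have DC c : D c%:MP = 0.
  by rewrite /D big1 // => i _; rewrite mderivC meval0 mulr0.
have TC c : taylor_to c%:MP.
  by exists 0 => u; rewrite !mevalC DC horner0; ring.
have TX i : taylor_to 'X_i.
  exists 0 => u; rewrite !mevalXU horner0 /line mulr0 addr0; congr (_ + u * _).
  rewrite /D (bigD1 i) //= mderivX mnm1E eqxx scale1r.
  rewrite (_ : (U_(i) - U_(i))%MM = 0%MM); last first.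
    by apply/mnmP => j; rewrite mnmBE subnn mnm0E.
  rewrite mpolyX0 meval1 mulr1 big1 ?addr0 // => j /negPf ji.
  by rewrite mderivX mnm1E eq_sym ji scale0r meval0 mulr0.
elim/mpolyind: f => [|c m f _ _ [h Hh]].
  by rewrite -mpolyC0.
have [k Hk] : taylor_to (c *: 'X_[m]).
  rewrite -mul_mpolyC mpolyXE_id; apply: taylorM (TC c) _.
  elim/big_rec: _ => [|i g _ Hg]; first by rewrite -mpolyC1.
  apply: taylorM Hg; elim: (m i) => [|e IHe]; first by rewrite expr0 -mpolyC1.
  by rewrite exprS; apply: taylorM.
exists (k + h) => u; rewrite !mevalD Hk Hh hornerD.
have -> : D (c *: 'X_[m] + f) = D (c *: 'X_[m]) + D f.
  by rewrite /D -big_split; apply: eq_bigr => i _; rewrite mderivD mevalD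
    mulrDr.
by ring.
Qed.

End PolynomialFunctions.

(* If no nontrivial element fixed a point, the orbits would all have size 9. *)
Lemma order9_fixed_point (T : eqType) (f g : T -> T) (s : seq T) :
  (forall x, f (f (f x)) = x) -> (forall x, g (g (g x)) = x) ->
  (forall x, f (g x) = g (f x)) -> uniq s ->
  (forall x, x \in s -> f x \in s) -> (forall x, x \in s -> g x \in s) ->
  ~~ (9 %| size s)%N ->
  exists x i j, [/\ x \in s, (i < 3)%N, (j < 3)%N, (0 < i + j)%N
    & iter i f (iter j g x) = x].
Proof.
move=> f3 g3 fg.
have period (h : T -> T) i y : (forall y, h (h (h y)) = y) ->
    iter i h y = iter (i %% 3) h y.
  move=> h3; rewrite {1}(divn_eq i 3) addnC iterD; congr iter.
  by elim: (i %/ 3)%N => // k IHk; rewrite mulSn iterD IHk /= h3.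
have comm i j y : iter i f (iter j g y) = iter j g (iter i f y).
  elim: i => //= i ->; elim: j => //= j <-; exact: fg.
(* Induction on the size: when the orbit [o] of the first element has nine members, it is removed
   from [s]. *)
have [m] := ubnP (size s); elim: m s => // m IHm [|x s] // le_m us fs gs nd.
pose P i j y := iter i f (iter j g y) = y.
pose o := [:: x; f x; f (f x); g x; f (g x); f (f (g x));
  g (g x); f (g (g x)); f (f (g (g x)))].
have [uo|nuo] := boolP (uniq o); last first.
  pose act k := iter k.1 f (iter k.2 g x).
  pose ks := [:: (0, 0); (1, 0); (2, 0); (0, 1); (1, 1); (2, 1);
                 (0, 2); (1, 2); (2, 2)]%N.
  have [/hasP[k kks /andP[k0 /eqP kE]]|/hasPn nfix] :=
      boolP (has (fun k => (k != (0, 0)%N) && (act k == x)) ks).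
    have := allP (isT : all (fun k => (k != (0, 0)%N) ==>
      [&& k.1 < 3, k.2 < 3 & 0 < k.1 + k.2]%N) ks) k kks.
    rewrite k0 /= => /and3P[i3 j3 ij].
    by exists x, k.1, k.2; split=> //; apply: mem_head.
  case/negP: nuo; rewrite -[o]/(map act ks) map_inj_in_uniq // => k l kks lks E.
  have kl3 k' : k' \in ks -> (k'.1 < 3)%N && (k'.2 < 3)%N.
    exact: (allP (isT : all (fun k' => (k'.1 < 3) && (k'.2 < 3))%N ks)).
  have [/andP[k1 k2] /andP[l1 l2]] := (kl3 _ kks, kl3 _ lks).
  (* If [k] and [l] act alike on [x], their difference modulo 3 fixes [x]. *)
  pose d := (((3 - l.1) + k.1) %% 3, ((3 - l.2) + k.2) %% 3)%N.
  have dE : act d = x.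
    rewrite /act /= -!period // !iterD comm -[iter k.1 f _]/(act k) E /act.
    by rewrite -comm -!iterD !subnK 1?ltnW //= g3 f3.
  have dks : d \in ks.
    by rewrite /d; case: (_ %% 3)%N (ltn_pmod (3 - l.1 + k.1) (isT : 0 < 3)%N)
      => [|[|[|//]]] _; case: (_ %% 3)%N (ltn_pmod (3 - l.2 + k.2) (isT : 0 <
        3)%N) => [|[|[|//]]] _.
  have := nfix d dks; rewrite dE eqxx andbT negbK => /eqP[].
  case: k l k1 k2 l1 l2 {kks lks E d dE dks} => [a b] [a' b'] /=.
  by move=> *; congr pair; lia.
have so : {subset o <= x :: s}.
  move: (x :: s) (mem_head x s) fs gs => S xS fS gS y; rewrite !inE.
  by case/or4P => [/eqP->|/eqP->|/eqP->|]; auto;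
     case/or4P => [/eqP->|/eqP->|/eqP->|]; auto; case/or3P => /eqP->; auto 8.
pose s' := [seq y <- x :: s | y \notin o].
have size_s' : (size s' + 9 = size (x :: s))%N.
  have := count_predC (mem o) (x :: s); rewrite addnC => <-.
  rewrite size_filter; congr addn.
  rewrite -size_filter -[9%N]/(size o); apply/perm_size/uniq_perm => //.
    by rewrite filter_uniq.
  move=> y; rewrite mem_filter; apply/idP/andP => [yo|[]//].
  by split=> //; apply: so.
have closed (h k : T -> T) : (forall y, k (h y) = y) -> {homo k : y / y \in o}
  ->
    (forall y, y \in x :: s -> h y \in x :: s) -> forall y, y \in s' -> h y \in
      s'.
  move=> hk ko hs y; rewrite !mem_filter => /andP[yo ys]; rewrite hs // andbT.
  by apply: contra yo => /ko; rewrite hk.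
have fo : {homo f : y / y \in o}.
  by move=> y; rewrite !inE => /or4P[/eqP->|/eqP->|/eqP->|];
     rewrite ?f3 ?eqxx ?orbT //;
     case/or4P => [/eqP->|/eqP->|/eqP->|]; rewrite ?f3 ?eqxx ?orbT //;
     case/or3P => /eqP->; rewrite ?f3 ?eqxx ?orbT.
have go : {homo g : y / y \in o}.
  by move=> y; rewrite !inE => /or4P[/eqP->|/eqP->|/eqP->|];
     rewrite -?fg ?g3 ?eqxx ?orbT //;
     case/or4P => [/eqP->|/eqP->|/eqP->|]; rewrite -?fg ?g3 ?eqxx ?orbT //;
     case/or3P => /eqP->; rewrite -?fg ?g3 ?eqxx ?orbT.
have [] := IHm s'.
- by move: le_m; rewrite -size_s'; lia.
- by rewrite filter_uniq.
- by apply: (closed f (f \o f)) => //= y /fo/fo.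
- by apply: (closed g (g \o g)) => //= y /go/go.
- by move: nd; rewrite -size_s' dvdn_addl.
move=> y [i [j [ys i3 j3 ij E]]]; exists y, i, j; split=> //.
by move: ys; rewrite mem_filter => /andP[].
Qed.

(** * Maps induced on projective space *)

Section ProjectiveMaps.

Variables (K : fieldType) (V : vectType K).
Implicit Types (P : proj_space V) (v : V).

Definition proj_vect P : V := vpick (val P).

Lemma proj_vect_neq0 P : proj_vect P != 0.
Proof.
rewrite vpick0; apply/eqP => E; have := valP P.
by rewrite /= E dimv0.
Qed.

Lemma proj_vect_mem P : proj_vect P \in val P.
Proof. exact: memv_pick. Qed.

Lemma proj_line P v : v \in val P -> v != 0 -> val P = <[v]>%VS.
Proof.
move=> vP v0; apply/eqP; rewrite eq_sym -(geq_leqif (dimv_leqif_eq _)) -?memvE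
  //.
by rewrite dim_vline v0; case: P vP => L /= /eqP ->.
Qed.

Lemma proj_eq P P' v : v \in val P -> v \in val P' -> v != 0 -> P = P'.
Proof.
by move=> vP vP' v0; apply: val_inj; rewrite (proj_line vP v0) (proj_line vP'
  v0).
Qed.

Variable f : V -> V.
Hypothesis fZ : forall c v, f (c *: v) = c *: f v.
Hypothesis f_neq0 : forall v, v != 0 -> f v != 0.

Fact proj_map_subproof P : \dim <[f (proj_vect P)]>%VS == 1%N.
Proof. by rewrite dim_vline f_neq0 ?proj_vect_neq0. Qed.

(** The image is spanned by the image of a chosen vector; [proj_mapP] shows that, by homogeneity of
    [f], the choice does not matter. *)
Definition proj_map P : proj_space V := 
  exist (fun L : {vspace V} => is_true (\dim L == 1%N)) _ (proj_map_subproof P).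

Lemma proj_mapP P u :
  reflect (exists2 v, v \in val P & u = f v) (u \in val (proj_map P)).
Proof.
apply: (iffP (@vlineP _ _ _ (f (proj_vect P)))) => [[c ->]|[v]].
  by exists (c *: proj_vect P); rewrite ?fZ // memvZ // proj_vect_mem.
rewrite (proj_line (proj_vect_mem P) (proj_vect_neq0 P)) => /vlineP[c ->] ->.
by exists c; rewrite fZ.
Qed.

Lemma mem_proj_map P v : v \in val P -> f v \in val (proj_map P).
Proof. by move=> vP; apply/proj_mapP; exists v. Qed.

Lemma mem_iter_proj_map n P v :
  v \in val P -> iter n f v \in val (iter n proj_map P).
Proof. by move=> vP; elim: n => //= n; apply: mem_proj_map. Qed.

End ProjectiveMaps.

Lemma comp_mpoly_homog (R : comNzRingType) (n k d : nat) (p : {mpoly R[n]})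
    (lq : n.-tuple {mpoly R[k]}) :
  p \is d.-homog -> (forall i, tnth lq i \is 1.-homog) ->
  p \mPo lq \is d.-homog.
Proof.
move=> /dhomogP pd lq1; rewrite comp_mpolyE big_seq.
apply: rpred_sum => m /pd /= <-; apply: rpredZ; rewrite mdegE.
elim/big_rec2: _ => [|i e q _ qe]; first exact: dhomog1.
by apply: dhomogM => //; rewrite -[X in X.-homog]mul1n; apply: dhomogMn.
Qed.

(** * From the basis of simple roots to orthonormal coordinates *)

Section StandardCoordinates.

Variables (K : numFieldType) (s5 : K).
Hypothesis s5E : s5 * s5 = 5.
Local Notation f := ((1 + s5) / 2).
Local Notation g := ((s5 - 1) / 2).
Implicit Types (v : 'cV[K]_4) (x y z t : K).

Local Notation i0 := (0 : 'I_4).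
Local Notation i1 := (1 : 'I_4).
Local Notation i2 := (2 : 'I_4).
Local Notation i3 := (3 : 'I_4).

(* Coordinates of [v], given in the basis of simple roots, in an orthonormal
   basis for [h4_gram]. *)
Definition stdx v := (f * v i3 0 - v i2 0) / 2.
Definition stdy v := (g * v i1 0 - g * v i2 0 - v i3 0) / 2.
Definition stdz v := (f * v i2 0 - v i1 0 - g * v i3 0) / 2.
Definition stdt v := f * v i1 0 / 2 - v i0 0.

Lemma std_scale c v :
  (stdx (c *: v) = c * stdx v) * (stdy (c *: v) = c * stdy v)
  * (stdz (c *: v) = c * stdz v) * (stdt (c *: v) = c * stdt v).
Proof.
by split; [split; [split|]|]; rewrite /stdx /stdy /stdz /stdt !mxE; field.
Qed.

Definition root_coord_seq x y z t : seq K :=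
  [:: - (2 + s5) * (x + y + z) - t; - (3 + s5) * (x + y + z);
      - (5 + s5) / 2 * x - (2 + s5) * y - (3 + s5) / 2 * z;
      - x - (3 + s5) / 2 * y - (1 + s5) / 2 * z].

Definition root_coords x y z t : 'cV[K]_4 :=
  \col_k (root_coord_seq x y z t)`_k.

Lemma colP4 (u v : 'cV[K]_4) : u i0 0 = v i0 0 -> u i1 0 = v i1 0 ->
  u i2 0 = v i2 0 -> u i3 0 = v i3 0 -> u = v.
Proof.
move=> e0 e1 e2 e3; apply/colP => -[[|[|[|[|//]]]] k4].
- by rewrite (_ : Ordinal k4 = i0) //; apply: val_inj.
- by rewrite (_ : Ordinal k4 = i1) //; apply: val_inj.
- by rewrite (_ : Ordinal k4 = i2) //; apply: val_inj.
- by rewrite (_ : Ordinal k4 = i3) //; apply: val_inj.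
Qed.

Lemma root_coordsK x y z t : let v := root_coords x y z t in
  [/\ stdx v = x, stdy v = y, stdz v = z & stdt v = t].
Proof.
rewrite /stdx /stdy /stdz /stdt !mxE /=.
by split; field: s5E.
Qed.

Lemma stdK v : root_coords (stdx v) (stdy v) (stdz v) (stdt v) = v.
Proof.
by apply: colP4; rewrite !mxE /= /stdx /stdy /stdz /stdt; field: s5E.
Qed.

Lemma root_coords_linear x y z t x' y' z' t' u :
  root_coords (x + u * x') (y + u * y') (z + u * z') (t + u * t') =
  root_coords x y z t + u *: root_coords x' y' z' t'.
Proof. by apply: colP4; rewrite !mxE /=; field. Qed.

(** The matrix [formH4] with the cosines written algebraically: cos (pi / 5) is half the golden
    ratio. *)
Definition h4_gram : 'M[K]_4 :=
  \matrix_(i < 4, j < 4) nth 0 (nth [::]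
    [:: [:: 1; - (f / 2); 0; 0];
        [:: - (f / 2); 1; - (1 / 2); 0];
        [:: 0; - (1 / 2); 1; - (1 / 2)];
        [:: 0; 0; - (1 / 2); 1]] i) j.

Definition h4_refl (i : 'I_4) : 'M[K]_4 :=
  1%:M - 2%:R *: (delta_mx i 0 *m row i h4_gram).

Lemma h4_reflE (i : 'I_4) v (k : 'I_4) : (h4_refl i *m v) k 0 =
  v k 0 - (k == i)%:R * (2 * (h4_gram i i0 * v i0 0 + h4_gram i i1 * v i1 0
    + h4_gram i i2 * v i2 0 + h4_gram i i3 * v i3 0)).
Proof.
rewrite mulmxBl mul1mx -scalemxAl -mulmxA mxE [in LHS]mxE; congr (_ - _).
rewrite [in LHS]mxE mxE big_ord1 !mxE eqxx andbT mulrCA; congr (_ * (_ * _)).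
rewrite !big_ord_recl big_ord0 addr0 !mxE !addrA.
by congr (_ + _ + _ + _); congr (_ * v _ _); apply: val_inj.
Qed.

Variable F : {mpoly K[4]}.
Hypothesis Finv : forall i v, evalv F (h4_refl i *m v) = evalv F v.

Definition std_form x y z t : K := evalv F (root_coords x y z t).

Lemma std_form_refl (i : 'I_4) a b c d :
  (forall x y z t, let r := 2 * (a * x + b * y + c * z + d * t) in
    root_coords (x - r * a) (y - r * b) (z - r * c) (t - r * d) =
    h4_refl i *m root_coords x y z t) ->
  refl_invariant std_form a b c d.
Proof. by move=> E x y z t; rewrite /std_form E Finv. Qed.

Lemma std_form_refl0 : refl_invariant std_form 0 0 0 (-1).
Proof.
apply: (@std_form_refl i0) => x y z t /=.
by apply: colP4; rewrite h4_reflE !mxE /=; field: s5E.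
Qed.

Lemma std_form_refl1 :
  refl_invariant std_form 0 (g / 2) (- 1 / 2) (f / 2).
Proof.
apply: (@std_form_refl i1) => x y z t /=.
by apply: colP4; rewrite h4_reflE !mxE /=; field: s5E.
Qed.

Lemma std_form_refl2 :
  refl_invariant std_form (- 1 / 2) (- g / 2) (f / 2) 0.
Proof.
apply: (@std_form_refl i2) => x y z t /=.
by apply: colP4; rewrite h4_reflE !mxE /=; field: s5E.
Qed.

Lemma std_form_refl3 :
  refl_invariant std_form (f / 2) (- 1 / 2) (- g / 2) 0.
Proof.
apply: (@std_form_refl i3) => x y z t /=.
by apply: colP4; rewrite h4_reflE !mxE /=; field: s5E.
Qed.

Hypothesis Fhomog : F \is 12.-homog.

Lemma std_form_monomials : exists s : seq 'X_{1..4}, exists c : 'X_{1..4} -> K,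
  {in s, forall m : 'X_{1..4}, m i0 + m i1 + m i2 + m i3 = 12}%N /\
  forall x y z t, std_form x y z t = \sum_(m <- s) c m *
    monomial4 (m i0) (m i1) (m i2) (m i3) x y z t.
Proof.
(* These linear forms are the entries of [root_coords], so [P] is [F] written in orthonormal
   coordinates. *)
pose lin (k : 'I_4) : {mpoly K[4]} :=
  (root_coord_seq 1 0 0 0)`_k *: 'X_i0 + (root_coord_seq 0 1 0 0)`_k *: 'X_i1
  + (root_coord_seq 0 0 1 0)`_k *: 'X_i2 + (root_coord_seq 0 0 0 1)`_k *: 'X_i3.
pose P := F \mPo [tuple lin k | k < 4].
have lin_homog k : lin k \is 1.-homog.
  by rewrite !rpredD // rpredZ // dhomogX /= mdeg1.
have sum4 (h : 'I_4 -> nat) : (\sum_i h i = h i0 + h i1 + h i2 + h i3)%N.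
  rewrite !big_ord_recl big_ord0 addn0 !addnA.
  by congr (h _ + h _ + h _ + h _)%N; apply: val_inj.
have /dhomogP Phomog : P \is 12.-homog.
  by apply: comp_mpoly_homog => // k; rewrite tnth_mktuple.
exists (msupp P), (fun m => P@_m); split=> [m /Phomog <-|x y z t].
  by rewrite /= mdegE sum4.
have -> : std_form x y z t = P.@[fun k => [:: x; y; z; t]`_k].
  rewrite /std_form /evalv comp_mpoly_meval; apply: meval_eq => k.
  rewrite tnth_mktuple /lin !mevalD !mevalZ !mevalXU mxE /=.
  by case: k => [[|[|[|[|//]]]] ?] /=; field.
rewrite mevalE; apply: eq_bigr => m _; congr (_ * _).
rewrite /monomial4 !big_ord_recl big_ord0 mulr1 !mulrA.
by congr (_ ^+ m _ * _ ^+ m _ * _ ^+ m _ * _ ^+ m _); apply: val_inj.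
Qed.

Lemma std_form_h4_form :
  exists al be, forall x y z t, std_form x y z t = h4_form s5 al be x y z t.
Proof.
have [s [c [deg12 pE]]] := std_form_monomials.
have p0 := std_form_refl0; have p1 := std_form_refl1.
have p2 := std_form_refl2; have p3 := std_form_refl3.
have [q qspan pq] := invariant_a4_span (signx_invariant s5E p0 p1 p2 p3)
  (signy_invariant s5E p0 p1 p2 p3) (signz_invariant s5E p0 p1 p2 p3)
  (signt_invariant p0) (cycle_xyz_invariant s5E p2 p3)
  (cycle_yzt_invariant s5E p0 p1 p2 p3) deg12 pE.
have [al [be qE]] := a4_span_reflection s5E p3 qspan pq.
by exists al, be => x y z t; rewrite pq qE.
Qed.

End StandardCoordinates.

(** * Singular points in terms of restrictions to lines *)

Section SingularPoints.

Variables (K : numFieldType) (n : nat) (F : {mpoly K[n]}).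

Definition flat_vect (v : 'cV[K]_n) : Prop :=
  forall d, exists h : {poly K}, forall u,
    evalv F (v + u *: d) = u ^+ 2 * h.[u].

(** A consequence of the Taylor expansion. The right-hand side involves only values of [F], so it is
    easily transported by the symmetries of [F]. *)
Lemma singular_pointP (P : proj_space 'cV[K]_n) :
  singular_point F P <-> (forall v, v \in val P -> flat_vect v).
Proof.
have taylor (v d : 'cV[K]_n) : exists h : {poly K}, forall u,
    evalv F (v + u *: d) = evalv F v
      + u * (\sum_i d i 0 * evalv F^`M(i) v) + u ^+ 2 * h.[u].
  have [h Hh] := meval_taylor (fun i => v i 0) (fun i => d i 0) F.
  exists h => u; rewrite -Hh; apply: meval_eq => i; by rewrite !mxE.
split=> [[F0 dF0] v vP d|Fflat].
  have [h Hh] := taylor v d; exists h => u; rewrite Hh F0 // big1 => [|i _].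
    by rewrite mulr0 !add0r.
  by rewrite dF0 ?mulr0.
have Pflat v : v \in val P ->
    evalv F v = 0 /\ forall i, evalv F^`M(i) v = 0.
  move=> vP; have F0 : evalv F v = 0.
    have [h Hh] := Fflat v vP 0; have := Hh 0.
    by rewrite scale0r addr0 expr0n mul0r.
  split=> // i; have [h Hh] := Fflat v vP (delta_mx i 0).
  have [k Hk] := taylor v (delta_mx i 0).
  set c := \sum_j _ in Hk.
  have -> : evalv F^`M(i) v = c.
    rewrite /c (bigD1 i) //= mxE !eqxx mul1r big1 ?addr0 // => j /negPf ji.
    by rewrite mxE ji mul0r.
  (* Both expansions along the same line agree; cancelling 'X and evaluating at 0 isolates the
     partial derivative. *)
  have : 'X * (c%:P + 'X * (k - h)) = 0.
    apply: horner_inj => u; rewrite !hornerE.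
    have := Hk u; rewrite Hh F0 add0r => /eqP; rewrite -subr_eq0 => /eqP E.
    rewrite -[RHS]oppr0 -[Z in _ = - Z]E; ring.
  move=> /eqP; rewrite mulf_eq0 polyX_eq0 /= => /eqP E.
  by have := congr1 (horner^~ 0) E; rewrite !hornerE.
by split=> [v /Pflat[]//|i v /Pflat[_]].
Qed.

End SingularPoints.
Arguments flat_vect {K n} F v.

(** * The group of order 9 acting on the singular points *)

Section EigenvectorSearch.

Variables (K : numFieldType) (s5 th : K) (F : {mpoly K[4]}).
Hypothesis s5E : s5 * s5 = 5.
Hypothesis thE : th * th = - 3.
Hypothesis Finv : forall i v, evalv F (h4_refl s5 i *m v) = evalv F v.
Local Notation p := (std_form s5 F).
Local Notation root_coords := (root_coords s5).
Local Notation stdx := (stdx s5).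
Local Notation stdy := (stdy s5).
Local Notation stdz := (stdz s5).
Local Notation stdt := (stdt s5).
Implicit Types v d : 'cV[K]_4.

Definition flat_std v := flat p (stdx v) (stdy v) (stdz v) (stdt v).

Lemma flat_vect_std v : flat_vect F v <-> flat_std v.
Proof.
split=> [vflat x y z t|vflat d].
  have [h Hh] := vflat (root_coords x y z t); exists h => u.
  by rewrite -Hh /std_form root_coords_linear (stdK s5E).
have [h Hh] := vflat (stdx d) (stdy d) (stdz d) (stdt d); exists h => u.
by rewrite -Hh /std_form root_coords_linear !(stdK s5E).
Qed.

Definition cycle_map v := root_coords (stdx v) (stdz v) (stdt v) (stdy v).

Definition rot_map v :=
  let h := (stdx v + stdy v + stdz v + stdt v) / 2 in
  root_coords (h - stdx v) (stdy v - h) (stdz v - h) (stdt v - h).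

Lemma std_root x y z t :
  (stdx (root_coords x y z t) = x) * (stdy (root_coords x y z t) = y) *
  (stdz (root_coords x y z t) = z) * (stdt (root_coords x y z t) = t).
Proof. by have [] := root_coordsK s5E x y z t. Qed.

Lemma root_coords_scale c x y z t :
  root_coords (c * x) (c * y) (c * z) (c * t) = c *: root_coords x y z t.
Proof. by apply: colP4; rewrite !mxE /=; field. Qed.

Lemma cycle_mapZ c v : cycle_map (c *: v) = c *: cycle_map v.
Proof. by rewrite /cycle_map !std_scale root_coords_scale. Qed.

Lemma rot_mapZ c v : rot_map (c *: v) = c *: rot_map v.
Proof.
rewrite /rot_map !std_scale -root_coords_scale.
by congr root_coords; field.
Qed.

Lemma cycle_map3 v : cycle_map (cycle_map (cycle_map v)) = v.
Proof. by rewrite /cycle_map !std_root (stdK s5E). Qed.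

Lemma rot_map3 v : rot_map (rot_map (rot_map v)) = v.
Proof.
rewrite /rot_map !std_root -[RHS](stdK s5E).
by congr root_coords; field.
Qed.

Lemma cycle_rot v : cycle_map (rot_map v) = rot_map (cycle_map v).
Proof.
rewrite /rot_map /cycle_map !std_root.
by congr root_coords; field.
Qed.

Lemma flat_std_cycle v : flat_std v -> flat_std (cycle_map v).
Proof.
rewrite /flat_std /cycle_map !std_root => vflat x y z t.
have [h Hh] := vflat x t y z; exists h => u; rewrite -Hh.
by rewrite [RHS](cycle_yzt_invariant s5E (std_form_refl0 s5E Finv)
  (std_form_refl1 s5E Finv) (std_form_refl2 s5E Finv) (std_form_refl3 s5E
    Finv)).
Qed.

Lemma flat_std_rot v : flat_std v -> flat_std (rot_map v).
Proof.
rewrite /flat_std /rot_map !std_root => vflat x y z t.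
pose h' := (x + y + z + t) / 2.
have [h Hh] := vflat (- h') (y - h' + x) (z - h' + x) (t - h' + x).
exists h => u; rewrite -Hh /h'.
rewrite -[RHS](rot3_invariant s5E (std_form_refl0 s5E Finv)
  (std_form_refl1 s5E Finv) (std_form_refl2 s5E Finv) (std_form_refl3 s5E
    Finv)).
by congr (std_form _ _); field.
Qed.

Let cycle0 v : v != 0 -> cycle_map v != 0.
Proof.
apply: contraNneq => v0; rewrite -(cycle_map3 v) v0 -(scale0r 0) !cycle_mapZ.
by rewrite !scale0r.
Qed.

Let rot0 v : v != 0 -> rot_map v != 0.
Proof.
apply: contraNneq => v0; rewrite -(rot_map3 v) v0 -(scale0r 0) !rot_mapZ.
by rewrite !scale0r.
Qed.

(** Both maps preserve flatness, hence permute the singular points, and [order9_fixed_point]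
    applies. A vector spanning a fixed point is an eigenvector. *)
Lemma singular_eigenvector (s : seq (proj_space 'cV[K]_4)) :
  uniq s -> ~~ (9 %| size s)%N -> (forall P, P \in s <-> singular_point F P) ->
  exists v c i j, [/\ v != 0, flat_std v, (i < 3)%N && (j < 3)%N, (0 < i + j)%N
    & iter i cycle_map (iter j rot_map v) = c *: v].
Proof.
move=> us s9 sP; pose cyc := proj_map cycle0; pose rot := proj_map rot0.
have memc := mem_proj_map cycle_mapZ cycle0.
have memr := mem_proj_map rot_mapZ rot0.
have vect0 := @proj_vect_neq0 _ 'cV[K]_4.
have vectP := @proj_vect_mem _ 'cV[K]_4.
have [] := @order9_fixed_point _ cyc rot s.
- move=> P; apply: (proj_eq _ (vectP P) (vect0 P)).
  by rewrite -(cycle_map3 (proj_vect P)); do 3 apply/memc.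
- move=> P; apply: (proj_eq _ (vectP P) (vect0 P)).
  by rewrite -(rot_map3 (proj_vect P)); do 3 apply/memr.
- move=> P; apply: (@proj_eq _ _ _ _ (cycle_map (rot_map (proj_vect P)))).
  + by apply/memc/memr.
  + by rewrite cycle_rot; apply/memr/memc.
  + by apply/cycle0/rot0.
- by [].
- move=> P /sP/singular_pointP Pflat; apply/sP/singular_pointP => ?.
  move=> /(proj_mapP cycle_mapZ cycle0)[v vP ->].
  by apply/flat_vect_std/flat_std_cycle/flat_vect_std/Pflat.
- move=> P /sP/singular_pointP Pflat; apply/sP/singular_pointP => ?.
  move=> /(proj_mapP rot_mapZ rot0)[v vP ->].
  by apply/flat_vect_std/flat_std_rot/flat_vect_std/Pflat.
- by [].
move=> P [i [j [Ps i3 j3 ij E]]]; pose v := proj_vect P.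
have : iter i cycle_map (iter j rot_map v) \in val P.
  rewrite -[X in val X]E; apply: (mem_iter_proj_map cycle_mapZ cycle0).
  exact/(mem_iter_proj_map rot_mapZ rot0)/vectP.
rewrite (proj_line (vectP P) (vect0 P)) => /vlineP[c Ec].
exists v, c, i, j; split=> //; [exact: vect0| |by rewrite i3].
apply/flat_vect_std; move/sP/singular_pointP: Ps; apply; exact: vectP.
Qed.

Variables al be : K.
Hypothesis al0 : al != 0.
Hypothesis pE : forall x y z t, p x y z t = h4_form s5 al be x y z t.

Lemma critical_of_singular_points (s : seq (proj_space 'cV[K]_4)) :
  uniq s -> ~~ (9 %| size s)%N -> (forall P, P \in s <-> singular_point F P) ->
  critical al be.
Proof.
move=> us s9 sP.
have [v [c [i [j [v0 vflat /andP[i3 j3] ij E]]]]] :=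
  singular_eigenvector us s9 sP.
have n3 : 3 != 0 :> K by rewrite pnatr_eq0.
have th0 : th != 0.
  apply/eqP => E0; move/eqP: thE; rewrite E0 mul0r eq_sym oppr_eq0.
  by rewrite (negPf n3).
pose w := (- 1 + th) / 2; pose w2 := (- 1 - th) / 2.
(* Coordinates with respect to the common eigenvectors; each is a linear form multiplied by a scalar
   under either map. *)
pose a0 v := (stdx v / th + (stdy v + stdz v + stdt v) / 3) / 2.
pose a1 v := (- stdx v / th + (stdy v + stdz v + stdt v) / 3) / 2.
pose a2 v := (stdy v + w2 * stdz v + w * stdt v) / 3.
pose a3 v := (stdy v + w * stdz v + w2 * stdt v) / 3.
have iterE (g : 'cV[K]_4 -> 'cV[K]_4) (a : 'cV[K]_4 -> K) l k u :
    (forall u, a (g u) = l * a u) -> a (iter k g u) = l ^+ k * a u.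
  by move=> agE; elim: k => [|k IHk]; rewrite ?mul1r // exprS iterS agE IHk
    mulrA.
have eigen (a : 'cV[K]_4 -> K) l m :
    (forall c u, a (c *: u) = c * a u) ->
    (forall u, a (cycle_map u) = l * a u) ->
    (forall u, a (rot_map u) = m * a u) -> c * a v = l ^+ i * (m ^+ j * a v).
  by move=> aZ acyc arot; rewrite -aZ -E (iterE _ _ l) // (iterE _ _ m).
have e0 : c * a0 v = w2 ^+ j * a0 v.
  rewrite -[RHS]mul1r -(expr1n _ i); apply: eigen => [b u|u|u].
  - by rewrite /a0 !std_scale; field; rewrite ?th0.
  - by rewrite /a0 /cycle_map !std_root; field; rewrite ?th0.
  - by rewrite /a0 /rot_map /w2 !std_root; field: thE; rewrite ?th0.
have e1 : c * a1 v = w ^+ j * a1 v.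
  rewrite -[RHS]mul1r -(expr1n _ i); apply: eigen => [b u|u|u].
  - by rewrite /a1 !std_scale; field; rewrite ?th0.
  - by rewrite /a1 /cycle_map !std_root; field; rewrite ?th0.
  - by rewrite /a1 /rot_map /w !std_root; field: thE; rewrite ?th0.
have e2 : c * a2 v = w ^+ i * a2 v.
  rewrite -[a2 v in RHS]mul1r -(expr1n _ j); apply: eigen => [b u|u|u].
  - by rewrite /a2 !std_scale; field.
  - by rewrite /a2 /cycle_map /w /w2 !std_root; field: thE.
  - by rewrite /a2 /rot_map /w /w2 !std_root; field: thE.
have e3 : c * a3 v = w2 ^+ i * a3 v.
  rewrite -[a3 v in RHS]mul1r -(expr1n _ j); apply: eigen => [b u|u|u].
  - by rewrite /a3 !std_scale; field.
  - by rewrite /a3 /cycle_map /w /w2 !std_root; field: thE.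
  - by rewrite /a3 /rot_map /w /w2 !std_root; field: thE.
have xE : stdx v = th * a0 v - th * a1 v by rewrite /a0 /a1; field; rewrite
  ?th0.
have yE : stdy v = a0 v + a1 v + a2 v + a3 v.
  by rewrite /a0 /a1 /a2 /a3 /w /w2; field; rewrite ?th0.
have zE : stdz v = a0 v + a1 v + w * a2 v + w2 * a3 v.
  by rewrite /a0 /a1 /a2 /a3 /w /w2; field: thE; rewrite ?th0.
have tE : stdt v = a0 v + a1 v + w2 * a2 v + w * a3 v.
  by rewrite /a0 /a1 /a2 /a3 /w /w2; field: thE; rewrite ?th0.
apply: (critical_eigenvector s5E thE al0 i3 j3 ij _ e0 e1 e2 e3).
  apply: contraNN v0 => /and4P[/eqP z0 /eqP z1 /eqP z2 /eqP z3].
  rewrite -[v](stdK s5E) xE yE zE tE z0 z1 z2 z3.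
  by apply/eqP/colP4; rewrite !mxE /=; field.
apply: (@flat_ext _ p _ _ _ _ _ pE); rewrite -/w -/w2.
by rewrite -xE -yE -zE -tE.
Qed.

End EigenvectorSearch.

(** * The dodecic with rational coefficients *)

Section RationalForm.

(** Integer multiples make sense in any commutative ring, so the same formula serves for scalars and
    for polynomials. The 330 is 33 * [s5] * 2 * [s5], the factor 2 * [s5] coming from the difference
    of the last two squares. *)
Definition rational_sextic (A : comNzRingType) (lam e1 e2 e3 e4 d : A) : A :=
  (e1 ^+ 4 * e2) *+ 2 - (e1 ^+ 3 * e3) *+ 2 - (e1 ^+ 2 * e2 ^+ 2) *+ 14
  + (e1 ^+ 2 * e4) *+ 365 - (e1 * e2 * e3) *+ 7 + (e2 ^+ 3) *+ 30
  + (e3 ^+ 2) *+ 21 - (e2 * e4) *+ 1080 - d *+ 330 + lam * e1 ^+ 6.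

(* In the coordinates [x], [y], [z], [t] with [z + s5 * t] and [z - s5 * t] as
   the last two standard coordinates, the [s5] in front of the Vandermonde
   determinant cancels against its antisymmetry. *)
Definition rational_dodecic (A : comNzRingType) (lam x y z t : A) : A :=
  let a := x ^+ 2 in let b := y ^+ 2 in
  let u := z ^+ 2 + t ^+ 2 *+ 5 in let v := (z * t) *+ 2 in
  let w := u ^+ 2 - v ^+ 2 *+ 5 in
  rational_sextic lam (a + b + u *+ 2) (a * b + (u * (a + b)) *+ 2 + w)
    ((a * b * u) *+ 2 + (a + b) * w) (a * b * w)
    (v * (a - b) * (a ^+ 2 - (u * a) *+ 2 + w) * (b ^+ 2 - (u * b) *+ 2 + w)).

Lemma rational_dodecicE (K : numFieldType) (s5 al lam x y z t : K) :
  s5 * s5 = 5 ->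
  h4_form s5 al (lam * al) x y (z + s5 * t) (z - s5 * t) =
  al * rational_dodecic lam x y z t.
Proof.
move=> s5E; rewrite /h4_form /a4_sextic /vandermonde4 /rational_dodecic
  /rational_sextic /=.
by ring: s5E.
Qed.

Lemma rational_sextic_rmorph (A B : comNzRingType) (h : {rmorphism A -> B})
    (lam e1 e2 e3 e4 d : A) (e1' e2' e3' e4' d' : B) :
  h e1 = e1' -> h e2 = e2' -> h e3 = e3' -> h e4 = e4' -> h d = d' ->
  h (rational_sextic lam e1 e2 e3 e4 d) =
  rational_sextic (h lam) e1' e2' e3' e4' d'.
Proof.
move=> <- <- <- <- <-.
have hB (p q : A) : h (p - q) = h p - h q by rewrite rmorphB.
have hD (p q : A) : h (p + q) = h p + h q by rewrite rmorphD.
have hM (p q : A) : h (p * q) = h p * h q by rewrite rmorphM.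
have hX (p : A) n : h (p ^+ n) = h p ^+ n by rewrite rmorphXn.
have hn (p : A) n : h (p *+ n) = h p *+ n by rewrite rmorphMn.
rewrite /rational_sextic hD 2!hB 2!hD hB hD 2!hB !hn (hM (e1 ^+ 4)).
rewrite (hM (e1 ^+ 3)) (hM _ (e2 ^+ 2)) (hM (e1 ^+ 2)) (hM (e1 * e2)).
by rewrite (hM e1) (hM e2) (hM lam) !hX.
Qed.

Lemma rational_sextic_homog (R : comNzRingType) n (lam : R)
    (e1 e2 e3 e4 d : {mpoly R[n]}) :
  e1 \is 2.-homog -> e2 \is 4.-homog -> e3 \is 6.-homog -> e4 \is 8.-homog ->
  d \is 12.-homog -> rational_sextic lam%:MP e1 e2 e3 e4 d \is 12.-homog.
Proof.
move=> h1 h2 h3 h4 hd; rewrite /rational_sextic mul_mpolyC.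
have M i j (p q : {mpoly R[n]}) : p \is i.-homog -> q \is j.-homog ->
  p * q \is (i + j).-homog by exact: dhomogM.
have X k i (p : {mpoly R[n]}) : p \is i.-homog -> p ^+ k \is (i * k).-homog.
  exact: dhomogMn.
have H12 : e1 ^+ 4 * e2 \is 12.-homog := M _ _ _ _ (X 4 _ _ h1) h2.
have H13 : e1 ^+ 3 * e3 \is 12.-homog := M _ _ _ _ (X 3 _ _ h1) h3.
have H122 : e1 ^+ 2 * e2 ^+ 2 \is 12.-homog :=
  M _ _ _ _ (X 2 _ _ h1) (X 2 _ _ h2).
have H14 : e1 ^+ 2 * e4 \is 12.-homog := M _ _ _ _ (X 2 _ _ h1) h4.
have H123 : e1 * e2 * e3 \is 12.-homog := M _ _ _ _ (M _ _ _ _ h1 h2) h3.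
have H222 : e2 ^+ 3 \is 12.-homog := X 3 _ _ h2.
have H33 : e3 ^+ 2 \is 12.-homog := X 2 _ _ h3.
have H24 : e2 * e4 \is 12.-homog := M _ _ _ _ h2 h4.
have H1 : e1 ^+ 6 \is 12.-homog := X 6 _ _ h1.
apply: rpredD (rpredZ _ H1); apply: rpredB (rpredMn _ hd).
apply: rpredB (rpredMn _ H24); apply: rpredD (rpredMn _ H33).
apply: rpredD (rpredMn _ H222); apply: rpredB (rpredMn _ H123).
apply: rpredD (rpredMn _ H14); apply: rpredB (rpredMn _ H122).
exact: rpredB (rpredMn _ H12) (rpredMn _ H13).
Qed.

(* Otherwise unification unfolds the numerals of [rational_sextic]. *)
Local Opaque rational_sextic.

Lemma rational_dodecic_rmorph (A B : comNzRingType) (h : {rmorphism A -> B})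
    (lam x y z t : A) :
  h (rational_dodecic lam x y z t) =
  rational_dodecic (h lam) (h x) (h y) (h z) (h t).
Proof.
have hB (p q : A) : h (p - q) = h p - h q by rewrite rmorphB.
have hD (p q : A) : h (p + q) = h p + h q by rewrite rmorphD.
have hM (p q : A) : h (p * q) = h p * h q by rewrite rmorphM.
have hX (p : A) n : h (p ^+ n) = h p ^+ n by rewrite rmorphXn.
have hn (p : A) n : h (p *+ n) = h p *+ n by rewrite rmorphMn.
rewrite /rational_dodecic -!hX.
set a := x ^+ 2; set b := y ^+ 2; set u := z ^+ 2 + _; set v := (z * t) *+ 2.
have -> : h (z ^+ 2) + h (t ^+ 2) *+ 5 = h u by rewrite /u hD hn.
have -> : (h z * h t) *+ 2 = h v by rewrite /v hn hM.
rewrite -(hX u) -(hX v).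
set w := u ^+ 2 - _.
have -> : h (u ^+ 2) - h (v ^+ 2) *+ 5 = h w by rewrite /w hB hn.
move: (w) (v) (u) (a) (b) => {w v u a b} w v u a b.
apply: rational_sextic_rmorph.
- by rewrite hD (hD a) hn.
- by rewrite hD (hD (a * b)) hM hn (hM u) hD.
- by rewrite hD hn (hM _ u) (hM a) hM hD.
- by rewrite hM (hM a).
rewrite hM (hM (_ * _)) (hM v) (hB a b) !(hD _ w) !hB !hn !(hM u).
by [].
Qed.

Definition rational_dodecic_mpoly (lam : rat) : {mpoly rat[4]} :=
  rational_dodecic lam%:MP ('X_0) ('X_1) ('X_2) ('X_3).

Lemma rational_dodecic_mpolyE (K : numFieldType) (lam : rat) (v : 'I_4 -> K) :
  (map_mpoly ratr (rational_dodecic_mpoly lam)).@[v] =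
  rational_dodecic (ratr lam) (v 0) (v 1) (v 2) (v 3).
Proof.
rewrite /rational_dodecic_mpoly !rational_dodecic_rmorph /=.
by rewrite map_mpolyC !map_mpolyX mevalC !mevalXU.
Qed.

Lemma rational_dodecic_mpoly_homog lam :
  rational_dodecic_mpoly lam \is 12.-homog.
Proof.
have X i : ('X_i : {mpoly rat[4]}) \is 1.-homog by rewrite dhomogX /= mdeg1.
have hX k (p : {mpoly rat[4]}) d : p \is d.-homog -> p ^+ k \is (d * k).-homog
  by exact: dhomogMn.
pose a : {mpoly rat[4]} := 'X_0 ^+ 2; pose b : {mpoly rat[4]} := 'X_1 ^+ 2.
have a2 : a \is 2.-homog := hX 2 _ 1 (X 0).
have b2 : b \is 2.-homog := hX 2 _ 1 (X 1).
rewrite /rational_dodecic_mpoly /rational_dodecic -/a -/b.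
set u := 'X_2 ^+ 2 + _; have u2 : u \is 2.-homog.
  by rewrite rpredD ?rpredMn ?(hX 2 _ 1).
set v := (_ * 'X_3) *+ 2; have v2 : v \is 2.-homog.
  by rewrite rpredMn // (dhomogM (X 2) (X 3)).
set w := u ^+ 2 - _; have w4 : w \is 4.-homog.
  by rewrite rpredB ?rpredMn ?(hX 2 _ 2).
have ab2 : a + b \is 2.-homog by rewrite rpredD.
have ab4 : a * b \is 4.-homog := dhomogM a2 b2.
have q4 x : x \is 2.-homog -> x ^+ 2 - (u * x) *+ 2 + w \is 4.-homog.
  by move=> x2; rewrite rpredD ?rpredB ?rpredMn ?(hX 2 _ 2) ?(dhomogM u2 x2).
apply: rational_sextic_homog.
- exact: rpredD ab2 (rpredMn _ u2).
- exact: rpredD (rpredD ab4 (rpredMn _ (dhomogM u2 ab2))) w4.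
- exact: rpredD (rpredMn _ (dhomogM ab4 u2)) (dhomogM ab2 w4).
- exact: dhomogM ab4 w4.
- exact: dhomogM (dhomogM (dhomogM v2 (rpredB a2 b2)) (q4 _ a2)) (q4 _ b2).
Qed.

End RationalForm.

Lemma meval_unit (K : fieldType) n (f : {mpoly K[n]}) v :
  f \is a GRing.unit -> f.@[v] != 0.
Proof.
move=> fU; apply/eqP => f0; have := congr1 (meval v) (mulrV fU).
by rewrite mevalM f0 mul0r meval1 => /eqP; rewrite eq_sym oner_eq0.
Qed.

(** * The rational equation in a suitable basis *)

Section RationalModel.

Variables (K : numFieldType) (s5 th : K) (F : {mpoly K[4]}).
Hypothesis s5E : s5 * s5 = 5.
Hypothesis thE : th * th = - 3.
Hypothesis Finv : forall i v, evalv F (h4_refl s5 i *m v) = evalv F v.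
Hypothesis Fhomog : F \is 12.-homog.
Hypothesis Firr : irreducible_mpoly F.
Local Notation f := ((1 + s5) / 2).
Local Notation g := ((s5 - 1) / 2).

Lemma evalv_h4_form al be v :
  (forall x y z t, std_form s5 F x y z t = h4_form s5 al be x y z t) ->
  evalv F v = h4_form s5 al be (stdx s5 v) (stdy s5 v) (stdz s5 v) (stdt s5 v).
Proof. by move=> <-; rewrite /std_form (stdK s5E). Qed.

Lemma evalv_col (h : {mpoly K[4]}) (v : 'I_4 -> K) : evalv h (\col_i v i) =
  h.@[v].
Proof. by apply: meval_eq => i; rewrite mxE. Qed.

Let quad : {mpoly K[4]} :=
  ((f / 2) *: 'X_3 - (1 / 2) *: 'X_2) ^+ 2
  + ((g / 2) *: 'X_1 - (g / 2) *: 'X_2 - (1 / 2) *: 'X_3) ^+ 2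
  + ((f / 2) *: 'X_2 - (1 / 2) *: 'X_1 - (g / 2) *: 'X_3) ^+ 2
  + ((f / 2) *: 'X_1 - 'X_0) ^+ 2.

Let quadE v : quad.@[v] = (f / 2 * v 3 - 1 / 2 * v 2) ^+ 2
  + (g / 2 * v 1 - g / 2 * v 2 - 1 / 2 * v 3) ^+ 2
  + (f / 2 * v 2 - 1 / 2 * v 1 - g / 2 * v 3) ^+ 2
  + (f / 2 * v 1 - v 0) ^+ 2.
Proof.
by rewrite /quad !mevalD !rmorphXn /= !mevalB !mevalZ !mevalXU.
Qed.

(** Otherwise [F] would be a multiple of the sixth power of [quad]. Both [quad] and its cofactor
    vanish at the origin, so neither would be a unit. *)
Lemma irreducible_al_neq0 al be :
  (forall x y z t, std_form s5 F x y z t = h4_form s5 al be x y z t) -> al != 0.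
Proof.
move=> FE; apply/eqP => al0.
have F_quad : F = quad * (be *: quad ^+ 5).
  apply/eqP; rewrite -subr_eq0; apply/eqP/meval_eq0 => v.
  rewrite mevalB mevalM mevalZ rmorphXn /= -evalv_col (evalv_h4_form _ FE) al0.
  rewrite quadE /h4_form mul0r add0r /stdx /stdy /stdz /stdt !mxE.
  by field.
have quad0 : quad.@[fun=> 0] = 0 by rewrite quadE; ring.
have [_ _ /(_ _ _ F_quad)[]] := Firr => /(meval_unit (fun=> 0)).
  by rewrite quad0 eqxx.
by rewrite mevalZ rmorphXn /= quad0 expr0n mulr0 eqxx.
Qed.

(** The vector with coordinates x, y, z, t in this basis has orthonormal coordinates x, y, z + [s5]
    t, z - [s5] t, as in [rational_dodecicE]. *)
Definition rational_basis : 4.-tuple 'cV[K]_4 :=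
  [tuple root_coords s5 1 0 0 0; root_coords s5 0 1 0 0;
         root_coords s5 0 0 1 1; root_coords s5 0 0 s5 (- s5)].

Definition rational_coord (v : 'cV[K]_4) (i : 'I_4) : K :=
  [:: stdx s5 v; stdy s5 v; (stdz s5 v + stdt s5 v) / 2;
      (stdz s5 v - stdt s5 v) / (2 * s5)]`_i.

Let s50 : s5 != 0.
Proof.
by apply/eqP => E; move/eqP: s5E; rewrite E mul0r eq_sym pnatr_eq0.
Qed.

Lemma rational_coord_sum v :
  v = \sum_i rational_coord v i *: rational_basis`_i.
Proof.
rewrite -[LHS](stdK s5E) !big_ord_recl big_ord0 addr0.
apply: colP4; rewrite /rational_coord /= !mxE /=; field: s5E; exact: s50.
Qed.

Lemma rational_basisP : basis_of fullv rational_basis.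
Proof.
rewrite basisEdim dimvf dim_matrix size_tuple andbT; apply/subvP => v _.
rewrite [v]rational_coord_sum; apply: memv_suml => i _; apply: memvZ.
by apply/memv_span/mem_nth; rewrite size_tuple.
Qed.

Lemma coord_rational_basis i v : coord rational_basis i v = rational_coord v i.
Proof.
rewrite {1}[v]rational_coord_sum coord_sum_free //.
exact: basis_free rational_basisP.
Qed.

Lemma rational_model (s : seq (proj_space 'cV[K]_4)) :
  uniq s -> ~~ (9 %| size s)%N -> (forall P, P \in s <-> singular_point F P) ->
  exists (b : 4.-tuple 'cV[K]_4) (h : {mpoly rat[4]}),
    [/\ basis_of fullv b, h != 0, h \is 12.-homog
      & forall P : proj_space 'cV[K]_4, on_locus F P <->
          forall v, v \in val P ->
            (map_mpoly ratr h).@[fun i => coord b i v] = 0].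
Proof.
move=> us s9 sP.
have [al [be FE]] := std_form_h4_form s5E Finv Fhomog.
have al0 := irreducible_al_neq0 FE.
have [lam be_lam] : exists lam : rat, be = ratr lam * al.
  have rat_quot (m n : nat) : ratr (- (m%:R / n%:R)) = - (m%:R / n%:R) :> K.
    by rewrite rmorphN /= fmorph_div !rmorph_nat.
  case: (critical_of_singular_points s5E thE Finv al0 FE us s9 sP) => ->.
  - by exists 0; rewrite rmorph0 mul0r.
  - by exists (- (22%:R / 243%:R)); rewrite rat_quot.
  - by exists (- (3%:R / 32%:R)); rewrite rat_quot.
have hE v : evalv F v =
    al * (map_mpoly ratr (rational_dodecic_mpoly lam)).@[fun i =>
      coord rational_basis i v].
  rewrite (evalv_h4_form _ FE) rational_dodecic_mpolyE !coord_rational_basis.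
  rewrite be_lam -(rational_dodecicE _ _ _ _ _ _ s5E) /rational_coord /=.
  set z := stdz s5 v; set t := stdt s5 v.
  have -> : (z + t) / 2 + s5 * ((z - t) / (2 * s5)) = z by field; exact: s50.
  by have -> : (z + t) / 2 - s5 * ((z - t) / (2 * s5)) = t by field; exact: s50.
exists rational_basis, (rational_dodecic_mpoly lam); split.
- exact: rational_basisP.
- apply/eqP => h0; have [/eqP[]] := Firr; apply: meval_eq0 => v.
  by rewrite -evalv_col hE h0 raddf0 meval0 mulr0.
- exact: rational_dodecic_mpoly_homog.
move=> P; split=> FP v vP; last by rewrite hE FP ?mulr0.
by apply: (mulfI al0); rewrite -hE mulr0 FP.
Qed.

End RationalModel.

(** * The cosines of pi / 3 and pi / 5 *)

Section CosineValues.

Import Order.TTheory.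

Variable R : realType.
Local Notation cos := (@trigo.cos R).
Local Notation pi := (@trigo.pi R).

Let cos_pi_sub x : cos (pi - x) = - cos x.
Proof. by rewrite trigo.cosB trigo.cospi trigo.sinpi; ring. Qed.

Let cos_pi_div_gt0 (n : nat) : (2 < n)%N -> 0 < cos (pi / n%:R).
Proof.
move=> n2; have n0 : 0 < n%:R :> R by rewrite ltr0n; lia.
have pi0 := @trigo.pi_gt0 R.
apply: trigo.cos_gt0_pihalf; apply/andP; split.
  by apply: (@lt_trans _ _ 0); rewrite ?oppr_lt0 ?divr_gt0.
have n2' : 2%:R < n%:R :> R by rewrite ltr_nat.
by rewrite ltr_pM2l // ltf_pV2 ?posrE.
Qed.

(** The angles pi - pi / 3 and 2 pi / 3 are equal; the duplication formula gives a quadratic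
    equation whose root -1 is excluded by positivity. *)
Lemma cos_pi3 : cos (pi / 3) = 1 / 2.
Proof.
have c0 := cos_pi_div_gt0 (isT : 2 < 3)%N; set c := cos _ in c0 *.
have : (2 * c - 1) * (c + 1) == 0.
  have : cos (pi - pi / 3) = cos ((pi / 3) *+ 2) by congr trigo.cos; field.
  rewrite cos_pi_sub trigo.cos_mulr2n -/c => E.
  by apply/eqP; rewrite -[RHS](subrr (- c)) {1}E; ring.
rewrite mulf_eq0 => /orP[/eqP E|]; last by rewrite gt_eqF // addr_gt0.
by apply: subr0_eq; rewrite -[RHS](mul0r (1 / 2)) -E; field.
Qed.

(** Likewise pi - 2 pi / 5 = 3 pi / 5 gives a cubic equation, from which the root -1 is split
    off. *)
Lemma cos_pi5 : 4 * cos (pi / 5) ^+ 2 - 2 * cos (pi / 5) - 1 = 0.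
Proof.
have c0 := cos_pi_div_gt0 (isT : 2 < 5)%N; set c := cos _ in c0 *.
have : (4 * c ^+ 2 - 2 * c - 1) * (c + 1) == 0.
  have : cos (pi - (pi / 5) *+ 2) = cos ((pi / 5) *+ 2 + pi / 5).
    by congr trigo.cos; field.
  rewrite cos_pi_sub (trigo.cosD (_ *+ 2)) trigo.cos_mulr2n trigo.sin_mulr2n -/c
    => E.
  have := trigo.cos2Dsin2 (pi / 5); rewrite -/c => s2.
  apply/eqP; rewrite -[RHS](subrr (- (c ^+ 2 *+ 2 - 1))) {1}E.
  have s2' : trigo.sin (pi / 5) ^+ 2 = 1 - c ^+ 2 
    by apply: (addrI (c ^+ 2)); rewrite s2; ring.
  by ring: s2'.
by rewrite mulf_eq0 => /orP[/eqP //|]; rewrite gt_eqF // addr_gt0.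
Qed.

End CosineValues.

Theorem proposition1p1 (R : realType) (f : {mpoly R[i][4]})
    (hf : sarti_equation f) :
  exists (b : 4.-tuple 'cV[R[i]]_4) (g : {mpoly rat[4]}),
    [/\ basis_of fullv b,
        g != 0,
        g \is 12.-homog
      & forall p : proj_space 'cV[R[i]]_4,
          on_locus f p <->
          forall v, v \in val p ->
            (map_mpoly ratr g).@[fun i => coord b i v] = 0].
Proof.
have [fhomog finv firr [s [us ss sP]] _] := hf.
pose c : R := @trigo.cos R (@trigo.pi R / 5).
(* Since cos (pi / 5) = (1 + sqrt 5) / 4, this is sqrt 5. *)
pose s5 : R[i] := (4 * c - 1)%:C%C.
have s5E : s5 * s5 = 5.
  rewrite /s5 -rmorphM /=.
  have -> : (4 * c - 1) * (4 * c - 1) = 5.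
    have := cos_pi5 R; rewrite -/c => E.
    by apply: subr0_eq; rewrite -[RHS](mulr0 4) -E; ring.
  by rewrite rmorph_nat.
pose th : R[i] := sqrtC (- 3).
have thE : th * th = - 3 by rewrite -expr2 sqrtCK.
have reflE i : reflH4 R i = h4_refl s5 i.
  rewrite /reflH4 /h4_refl; congr (_ - _ *: (_ *m row i _)).
  apply/matrixP => j k; rewrite !mxE.
  have v1 : (- @trigo.cos R (trigo.pi / 1%:R))%:C%C = 1.
    by rewrite divr1 trigo.cospi opprK rmorph1.
  have v2 : (- @trigo.cos R (trigo.pi / 2%:R))%:C%C = 0.
    by rewrite trigo.cos_pihalf oppr0 rmorph0.
  have v3 : (- @trigo.cos R (trigo.pi / 3%:R))%:C%C = - (1 / 2).
    by rewrite cos_pi3 rmorphN fmorph_div rmorph1 rmorph_nat.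
  have v5 : (- @trigo.cos R (trigo.pi / 5%:R))%:C%C = - ((1 + s5) / 2 / 2).
    rewrite -/c (_ : c = (1 + (4 * c - 1)) / 2 / 2); last by field.
    by rewrite rmorphN !fmorph_div rmorphD rmorph1 !rmorph_nat.
  by case: j => [[|[|[|[|//]]]] ?]; case: k => [[|[|[|[|//]]]] ?];
    rewrite /coxH4 /= ?v1 ?v2 ?v3 ?v5.
have finv' k v : evalv f (h4_refl s5 k *m v) = evalv f v.
  by apply: finv; exists [:: k]; rewrite big_seq1 reflE.
by apply: (rational_model s5E thE finv' fhomog firr us _ sP); rewrite ss.
Qed.
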